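(* Let $W$ be a $BGW(v,k,\lambda;\mathbb{Z}_n)$, and let $A_{0,i},A_1,A_{2,i},A_3$ ($0\le i\le n-1$) be the $2nv\times 2nv$ matrices associated with $W$ as defined in the context, which form a commutative association scheme (with $A_3=0$ omitted if $k=v$). Put $w=e^{2\pi\sqrt{-1}/n}$, and let the primitive idempotents be labelled as in the context. Then the first and second eigenmatrices $P,Q$ of this scheme are given as follows, where $i$ runs over $\{0,\dots,n-1\}$ and $j$ over $\{1,\dots,n-1\}$. 1. If $k=v$, then $$P=\begin{array}{c|ccc} & A_{0,i} & A_1 & A_{2,i} \\ \hline E_0 & 1 & n(v-1) & k \\ E_1 & 1 & n(v-1) & -k \\ E_2 & 1 & -n & 0 \\ E_{3,j} & w^{-ij} & 0 & \sqrt{k}\,w^{-ij} \\ E_{4,j} & w^{-ij} & 0 & -\sqrt{k}\,w^{-ij} \end{array}$$ $$Q=\begin{array}{c|ccccc} & E_0 & E_1 & E_2 & E_{3,j} & E_{4,j} \\ \hline A_{0,i} & 1 & 1 & 2(v-1) & v w^{ij} & v w^{ij} \\ A_1 & 1 & 1 & -2 & 0 & 0 \\ A_{2,i} & 1 & -1 & 0 & \frac{v}{\sqrt{k}}w^{ij} & -\frac{v}{\sqrt{k}}w^{ij} \end{array}$$ 2. If $k<v$, then $$P=\begin{array}{c|cccc} & A_{0,i} & A_1 & A_{2,i} & A_3 \\ \hline E_0 & 1 & n(v-1) & k & n(v-k) \\ E_1 & 1 & n(v-1) & -k & -n(v-k) \\ E_{2,1} & 1 & -n & \sqrt{\frac{k(v-k)}{v-1}}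 & -n\sqrt{\frac{k(v-k)}{v-1}} \\ E_{2,2} & 1 & -n & -\sqrt{\frac{k(v-k)}{v-1}} & n\sqrt{\frac{k(v-k)}{v-1}} \\ E_{3,j} & w^{-ij} & 0 & \sqrt{k}\,w^{-ij} & 0 \\ E_{4,j} & w^{-ij} & 0 & -\sqrt{k}\,w^{-ij} & 0 \end{array}$$ $$Q=\begin{array}{c|cccccc} & E_0 & E_1 & E_{2,1} & E_{2,2} & E_{3,j} & E_{4,j} \\ \hline A_{0,i} & 1 & 1 & v-1 & v-1 & v w^{ij} & v w^{ij} \\ A_1 & 1 & 1 & -1 & -1 & 0 & 0 \\ A_{2,i} & 1 & -1 & \sqrt{\frac{(v-1)(v-k)}{k}} & -\sqrt{\frac{(v-1)(v-k)}{k}} & \frac{v}{\sqrt{k}}w^{ij} & -\frac{v}{\sqrt{k}}w^{ij} \\ A_3 & 1 & -1 & -\sqrt{\frac{(v-1)k}{v-k}} & \sqrt{\frac{(v-1)k}{v-k}} & 0 & 0 \end{array}$$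
   Context: Balanced generalized weighing matrices. Let $\mathbb{Z}_n=\{\bar 0,\bar 1,\dots,\overline{n-1}\}$ be the additive cyclic group of order $n$. A $BGW(v,k,\lambda;\mathbb{Z}_n)$ is a $v\times v$ matrix $W=(w_{ij})$ with entries in $\mathbb{Z}_n\cup\{0\}$, where $0$ is a formal zero symbol different from the group element $\bar 0$, such that each row has exactly $k$ nonzero entries (entries in $\mathbb{Z}_n$) and, for any distinct rows $i,j$, the multiset $\{w_{i\ell}-w_{j\ell}\mid w_{i\ell},w_{j\ell}\in\mathbb{Z}_n\}$ contains every element of $\mathbb{Z}_n$ exactly $\lambda/n$ times. The matrices $B_i$. For $0\le i\le n-1$, $B_i$ is the $v\times v$ $(0,1)$-matrix with $(B_i)_{ab}=1$ if and only if $w_{ab}=\bar i$. Indices of $B$ are taken modulo $n$. The adjacency matrices. Let $C=\mathrm{circ}(0,1,0,\dots,0)$ be the $n\times n$ circulant permutation matrix with first row $(0,1,0,\dots,0)$; $I_m$ and $J_m$ denote the identity and all-ones matrices of order $m$. Define, for $0\le i\le n-1$, $$A_{0,i}=\begin{bmatrix} C^i\otimes I_v & 0 \\ 0 & C^i\otimes I_v \end{bmatrix},\qquad A_1=\begin{bmatrix} J_n\otimes(J_v-I_v) & 0 \\ 0 & J_n\otimes(J_v-I_v) \end{bmatrix},$$ $$A_{2,i}=\begin{bmatrix} 0 & \sum_{j=0}^{n-1}C^j\otimes B_{i+j} \\ \sum_{j=0}^{n-1}C^j\otimes B_{-i-j}^t & 0 \end{bmatrix},\qquad A_3=\begin{bmatrix}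 0 & J_n\otimes\left(J_v-\sum_{j=0}^{n-1}B_j\right) \\ J_n\otimes\left(J_v-\sum_{j=0}^{n-1}B_j^t\right) & 0 \end{bmatrix}.$$ Association schemes. A commutative association scheme with $d$ classes on a finite set $X$ is a collection of nonzero $(0,1)$-matrices $A_0,A_1,\dots,A_d$ indexed by $X$ such that: $A_0=I_{|X|}$; $\sum_{i=0}^d A_i=J_{|X|}$; $A_i^t\in\{A_1,\dots,A_d\}$ for every $i\in\{1,\dots,d\}$; every product $A_iA_j$ is a linear combination of $A_0,\dots,A_d$; and $A_iA_j=A_jA_i$ for all $i,j$. The complex span of the $A_i$ is a commutative algebra (the Bose-Mesner algebra), which has a basis of primitive idempotents $E_0=\frac{1}{|X|}J_{|X|},E_1,\dots,E_d$. The first eigenmatrix $P=(p_{ij})$ and the second eigenmatrix $Q=(q_{ij})$ are defined by $A_j=\sum_{i} p_{ij}E_i$ and $E_j=\frac{1}{|X|}\sum_{i} q_{ij}A_i$; thus rows of $P$ are indexed by idempotents and columns by adjacency matrices, and vice versa for $Q$. In the present case $|X|=2nv$ and the identity matrix is $A_{0,0}$. Labelling of the primitive idempotents. With $w=e^{2\pi\sqrt{-1}/n}$, $$E_0=\tfrac{1}{2nv}\Big(\sum_{j=0}^{n-1}(A_{0,j}+A_{2,j})+A_1+A_3\Big),\qquad E_1=\tfrac{1}{2nv}\Big(\sum_{j=0}^{n-1}(A_{0,j}-A_{2,j})+A_1-A_3\Big),$$ $$E_{2,1}=\tfrac{1}{2nv}\Big(\sum_{j=0}^{n-1}\big((v-1)A_{0,j}+\tfrac{\sqrt{(v-1)(v-k)}}{\sqrt{k}}A_{2,j}\big)-A_1-\tfrac{\sqrt{(v-1)k}}{\sqrt{v-k}}A_3\Big),$$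 $$E_{2,2}=\tfrac{1}{2nv}\Big(\sum_{j=0}^{n-1}\big((v-1)A_{0,j}-\tfrac{\sqrt{(v-1)(v-k)}}{\sqrt{k}}A_{2,j}\big)-A_1+\tfrac{\sqrt{(v-1)k}}{\sqrt{v-k}}A_3\Big),$$ and, for $i\in\{1,\dots,n-1\}$, $$E_{3,i}=\tfrac{1}{2nv}\sum_{j=0}^{n-1}w^{ij}\big(vA_{0,j}+\tfrac{v}{\sqrt{k}}A_{2,j}\big),\qquad E_{4,i}=\tfrac{1}{2nv}\sum_{j=0}^{n-1}w^{ij}\big(vA_{0,j}-\tfrac{v}{\sqrt{k}}A_{2,j}\big).$$ If $k<v$, the primitive idempotents are taken to be $E_0,E_1,E_{2,1},E_{2,2},E_{3,i},E_{4,i}$; if $k=v$ they are taken to be $E_0,E_1,E_2=E_{2,1}+E_{2,2},E_{3,i},E_{4,i}$ (the $A_3$ terms being absent, since $A_3=0$).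
   Formalization: For n≥3 the printed E_{3,i}, E_{4,i} are not idempotent; P, Q are proved for them as expansions, and primitivity (n≥3) only after replacing A_{2,i} by A_{2,-i}. Assumes v>1, k>0 and, if n=1 and k<v, also λ<k (else no scheme). *)

(* Defs.v *)
From HB Require Import structures.
From mathcomp Require Import all_boot all_order all_algebra.
From mathcomp Require Import complex mxtens.
From mathcomp Require Import reals trigo.

Set Implicit Arguments.
Unset Strict Implicit.
Unset Printing Implicit Defensive.

Import Order.TTheory GRing.Theory Num.Theory.
Local Open Scope ring_scope.

(** * Commutative association schemes *)

Section Schemes.
Variables (F : fieldType) (N : nat) (L : finType).
Implicit Types (A : L -> 'M[F]_N) (M e f : 'M[F]_N).

Definition in_span A M : Prop :=
  exists c : L -> F, M = \sum_l c l *: A l.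

(* [l0] is the label of the identity relation; there are [#|L| - 1] classes. *)
Definition comm_assoc_scheme (l0 : L) A : Prop :=
  (forall l, A l != 0) /\
  (forall l x y, A l x y = 0 \/ A l x y = 1) /\
  A l0 = 1%:M /\
  \sum_l A l = const_mx 1 /\
  (forall l, l != l0 -> exists2 l', l' != l0 & (A l)^T = A l') /\
  (forall l l', in_span A (A l *m A l')) /\
  (forall l l', A l *m A l' = A l' *m A l).

Definition primitive_idempotent A e : Prop :=
  [/\ in_span A e, e != 0, e *m e = e &
      forall f, in_span A f -> f *m f = f -> e *m f = f -> f = 0 \/ f = e].

Definition primitive_idempotents (K : finType) (k0 : K) A (E : K -> 'M[F]_N) :
    Prop :=
  [/\ E k0 = N%:R^-1 *: const_mx 1,
      injective E,
      (forall k, primitive_idempotent A (E k)) &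
      (forall e, primitive_idempotent A e -> exists k, e = E k)].

Definition first_eigenmatrix (K : finType) A (E : K -> 'M[F]_N)
    (P : K -> L -> F) : Prop :=
  forall l, A l = \sum_k P k l *: E k.

Definition second_eigenmatrix (K : finType) A (E : K -> 'M[F]_N)
    (Q : L -> K -> F) : Prop :=
  forall k, E k = N%:R^-1 *: \sum_l Q l k *: A l.

End Schemes.

(** * Balanced generalized weighing matrices *)

(* The cyclic group of order n is 'I_m.+1 with n = m.+1 (this includes n = 1,
   which 'Z_n would not); [None] is the formal zero symbol. *)
Definition is_BGW (m v k lam : nat) (W : 'M[option 'I_m.+1]_v) : Prop :=
  (forall i, #|[set l | W i l != None]| = k) /\
  (forall i j, i != j -> forall g : 'I_m.+1,
     muln #|[set l | match W i l, W j l with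
                     | Some a, Some b => a - b == g :> 'I_m.+1
                     | _, _ => false
                     end]| m.+1 = lam).

(** * Labels of the relations and of the idempotents *)

Section Labels.
Variable m : nat.

Definition nonzero_idx := {j : 'I_m.+1 | j != 0}.

(* [rel_lt], [idm_lt]: the case k < v; [rel_eq], [idm_eq]: the case k = v. *)
Inductive rel_lt := LA0 of 'I_m.+1 | LA1 | LA2 of 'I_m.+1 | LA3.
Inductive rel_eq := MA0 of 'I_m.+1 | MA1 | MA2 of 'I_m.+1.
Inductive idm_lt :=
  LE0 | LE1 | LE21 | LE22 | LE3 of nonzero_idx | LE4 of nonzero_idx.
Inductive idm_eq := ME0 | ME1 | ME2 | ME3 of nonzero_idx | ME4 of nonzero_idx.

Definition rel_lt_enc (x : rel_lt) : 'I_m.+1 + 'I_m.+1 + bool :=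
  match x with
  | LA0 i => inl (inl i) | LA2 i => inl (inr i)
  | LA1 => inr true | LA3 => inr false
  end.
Definition rel_lt_dec (y : 'I_m.+1 + 'I_m.+1 + bool) : rel_lt :=
  match y with
  | inl (inl i) => LA0 i | inl (inr i) => LA2 i
  | inr true => LA1 | inr false => LA3
  end.
Lemma rel_lt_encK : cancel rel_lt_enc rel_lt_dec. Proof. by case. Qed.

Definition rel_eq_enc (x : rel_eq) : 'I_m.+1 + 'I_m.+1 + unit :=
  match x with
  | MA0 i => inl (inl i) | MA2 i => inl (inr i) | MA1 => inr tt
  end.
Definition rel_eq_dec (y : 'I_m.+1 + 'I_m.+1 + unit) : rel_eq :=
  match y with
  | inl (inl i) => MA0 i | inl (inr i) => MA2 i | inr _ => MA1
  end.
Lemma rel_eq_encK : cancel rel_eq_enc rel_eq_dec. Proof. by case. Qed.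

Definition idm_lt_enc (x : idm_lt) :
    nonzero_idx + nonzero_idx + (bool * bool) :=
  match x with
  | LE3 j => inl (inl j) | LE4 j => inl (inr j)
  | LE0 => inr (true, true) | LE1 => inr (true, false)
  | LE21 => inr (false, true) | LE22 => inr (false, false)
  end.
Definition idm_lt_dec (y : nonzero_idx + nonzero_idx + (bool * bool)) :
    idm_lt :=
  match y with
  | inl (inl j) => LE3 j | inl (inr j) => LE4 j
  | inr (true, true) => LE0 | inr (true, false) => LE1
  | inr (false, true) => LE21 | inr (false, false) => LE22
  end.
Lemma idm_lt_encK : cancel idm_lt_enc idm_lt_dec. Proof. by case. Qed.

Definition idm_eq_enc (x : idm_eq) : nonzero_idx + nonzero_idx + option bool :=
  match x with
  | ME3 j => inl (inl j) | ME4 j => inl (inr j)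
  | ME0 => inr (Some true) | ME1 => inr (Some false) | ME2 => inr None
  end.
Definition idm_eq_dec (y : nonzero_idx + nonzero_idx + option bool) : idm_eq :=
  match y with
  | inl (inl j) => ME3 j | inl (inr j) => ME4 j
  | inr (Some true) => ME0 | inr (Some false) => ME1 | inr None => ME2
  end.
Lemma idm_eq_encK : cancel idm_eq_enc idm_eq_dec. Proof. by case. Qed.

HB.instance Definition _ := Finite.copy rel_lt (can_type rel_lt_encK).
HB.instance Definition _ := Finite.copy rel_eq (can_type rel_eq_encK).
HB.instance Definition _ := Finite.copy idm_lt (can_type idm_lt_encK).
HB.instance Definition _ := Finite.copy idm_eq (can_type idm_eq_encK).

End Labels.

Arguments LA1 {m}. Arguments LA3 {m}. Arguments MA1 {m}.
Arguments LE0 {m}. Arguments LE1 {m}. Arguments LE21 {m}. Arguments LE22 {m}.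
Arguments ME0 {m}. Arguments ME1 {m}. Arguments ME2 {m}.

(** * Adjacency matrices and idempotents attached to a BGW *)

Section Matrices.
Variables (R : realType) (m v k : nat) (W : 'M[option 'I_m.+1]_v).

Local Notation C := R[i].
Local Notation n := (m.+1).
Local Notation order := (n * v + n * v)%N.

Definition circ (r : 'I_n -> C) : 'M[C]_n := \matrix_(a, b) r (b - a).

(* [Zp1] is the residue of 1; for n = 1 it is 0, so that C is then [1]. *)
Definition Cmx : 'M[C]_n := circ (fun j => (j == Zp1)%:R).

Definition Jmx (p : nat) : 'M[C]_p := const_mx 1.

Definition Bmx (i : 'I_n) : 'M[C]_v := \matrix_(a, b) (W a b == Some i)%:R.

Definition A0 (i : 'I_n) : 'M[C]_order :=
  block_mx (Cmx ^+ i *t 1%:M) 0 0 (Cmx ^+ i *t 1%:M).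

Definition A1 : 'M[C]_order :=
  block_mx (Jmx n *t (Jmx v - 1%:M)) 0 0 (Jmx n *t (Jmx v - 1%:M)).

Definition A2 (i : 'I_n) : 'M[C]_order :=
  block_mx 0 (\sum_(j < n) Cmx ^+ j *t Bmx (i + j))
           (\sum_(j < n) Cmx ^+ j *t (Bmx (- i - j))^T) 0.

Definition A3 : 'M[C]_order :=
  block_mx 0 (Jmx n *t (Jmx v - \sum_(j < n) Bmx j))
           (Jmx n *t (Jmx v - \sum_(j < n) (Bmx j)^T)) 0.

(* Pitfall: A0 i *m A2 l = A2 (l - i), whereas A0 i *m A0 l = A0 (i + l).
   Hence E3 and E4 below, formed with the family [A2], satisfy the expansions
   that define the eigenmatrices, but they are idempotent only when n <= 2;
   formed with the reindexed family i |-> A2 (- i) they are the primitive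
   idempotents for every n. [opp = false] is the family [A2] itself, and
   [opp = true] is the reindexed one. *)
Definition A2_ (opp : bool) (i : 'I_n) : 'M[C]_order :=
  A2 (if opp then - i else i).

Definition omega : C :=
  Complex (cos (2 * pi / n%:R)) (sin (2 * pi / n%:R)).

Definition sqC (x : R) : C := real_complex R (Num.sqrt x).

Local Notation vR := (v%:R : R).
Local Notation kR := (k%:R : R).
Local Notation vC := (v%:R : C).
Local Notation kC := (k%:R : C).
Local Notation nC := (n%:R : C).
Local Notation c0 := ((2 * n * v)%:R^-1 : C).

Section Orientation.
Variable opp : bool.
Local Notation A2 := (A2_ opp).

Definition E0 : 'M[C]_order :=
  c0 *: (\sum_(j < n) (A0 j + A2 j) + A1 + A3).

Definition E1 : 'M[C]_order :=
  c0 *: (\sum_(j < n) (A0 j - A2 j) + A1 - A3).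

Definition E21 : 'M[C]_order :=
  c0 *: (\sum_(j < n) ((vC - 1) *: A0 j +
           (sqC ((vR - 1) * (vR - kR)) / sqC kR) *: A2 j)
         - A1 - (sqC ((vR - 1) * kR) / sqC (vR - kR)) *: A3).

Definition E22 : 'M[C]_order :=
  c0 *: (\sum_(j < n) ((vC - 1) *: A0 j -
           (sqC ((vR - 1) * (vR - kR)) / sqC kR) *: A2 j)
         - A1 + (sqC ((vR - 1) * kR) / sqC (vR - kR)) *: A3).

Definition E3 (i : 'I_n) : 'M[C]_order :=
  c0 *: \sum_(j < n) omega ^+ (i * j) *: (vC *: A0 j + (vC / sqC kR) *: A2 j).

Definition E4 (i : 'I_n) : 'M[C]_order :=
  c0 *: \sum_(j < n) omega ^+ (i * j) *: (vC *: A0 j - (vC / sqC kR) *: A2 j).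

Definition adj_lt (l : rel_lt m) : 'M[C]_order :=
  match l with LA0 i => A0 i | LA1 => A1 | LA2 i => A2 i | LA3 => A3 end.

Definition adj_eq (l : rel_eq m) : 'M[C]_order :=
  match l with MA0 i => A0 i | MA1 => A1 | MA2 i => A2 i end.

Definition idem_lt (e : idm_lt m) : 'M[C]_order :=
  match e with
  | LE0 => E0 | LE1 => E1 | LE21 => E21 | LE22 => E22
  | LE3 j => E3 (val j) | LE4 j => E4 (val j)
  end.

(* When k = v, A3 = 0 and its coefficients cancel in E21 + E22. *)
Definition idem_eq (e : idm_eq m) : 'M[C]_order :=
  match e with
  | ME0 => E0 | ME1 => E1 | ME2 => E21 + E22
  | ME3 j => E3 (val j) | ME4 j => E4 (val j)
  end.

End Orientation.

Definition P_eq (e : idm_eq m) (l : rel_eq m) : C :=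
  match e, l with
  | ME0, MA0 _ => 1
  | ME0, MA1 => nC * (vC - 1)
  | ME0, MA2 _ => kC
  | ME1, MA0 _ => 1
  | ME1, MA1 => nC * (vC - 1)
  | ME1, MA2 _ => - kC
  | ME2, MA0 _ => 1
  | ME2, MA1 => - nC
  | ME2, MA2 _ => 0
  | ME3 j, MA0 i => omega ^- (i * val j)
  | ME3 _, MA1 => 0
  | ME3 j, MA2 i => sqC kR * omega ^- (i * val j)
  | ME4 j, MA0 i => omega ^- (i * val j)
  | ME4 _, MA1 => 0
  | ME4 j, MA2 i => - sqC kR * omega ^- (i * val j)
  end.

Definition Q_eq (l : rel_eq m) (e : idm_eq m) : C :=
  match l, e with
  | MA0 _, ME0 => 1
  | MA0 _, ME1 => 1
  | MA0 _, ME2 => 2 * (vC - 1)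
  | MA0 i, ME3 j => vC * omega ^+ (i * val j)
  | MA0 i, ME4 j => vC * omega ^+ (i * val j)
  | MA1, ME0 => 1
  | MA1, ME1 => 1
  | MA1, ME2 => - 2
  | MA1, ME3 _ => 0
  | MA1, ME4 _ => 0
  | MA2 _, ME0 => 1
  | MA2 _, ME1 => - 1
  | MA2 _, ME2 => 0
  | MA2 i, ME3 j => vC / sqC kR * omega ^+ (i * val j)
  | MA2 i, ME4 j => - (vC / sqC kR) * omega ^+ (i * val j)
  end.

Definition P_lt (e : idm_lt m) (l : rel_lt m) : C :=
  match e, l with
  | LE0, LA0 _ => 1
  | LE0, LA1 => nC * (vC - 1)
  | LE0, LA2 _ => kC
  | LE0, LA3 => nC * (vC - kC)
  | LE1, LA0 _ => 1
  | LE1, LA1 => nC * (vC - 1)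
  | LE1, LA2 _ => - kC
  | LE1, LA3 => - nC * (vC - kC)
  | LE21, LA0 _ => 1
  | LE21, LA1 => - nC
  | LE21, LA2 _ => sqC (kR * (vR - kR) / (vR - 1))
  | LE21, LA3 => - nC * sqC (kR * (vR - kR) / (vR - 1))
  | LE22, LA0 _ => 1
  | LE22, LA1 => - nC
  | LE22, LA2 _ => - sqC (kR * (vR - kR) / (vR - 1))
  | LE22, LA3 => nC * sqC (kR * (vR - kR) / (vR - 1))
  | LE3 j, LA0 i => omega ^- (i * val j)
  | LE3 _, LA1 => 0
  | LE3 j, LA2 i => sqC kR * omega ^- (i * val j)
  | LE3 _, LA3 => 0
  | LE4 j, LA0 i => omega ^- (i * val j)
  | LE4 _, LA1 => 0
  | LE4 j, LA2 i => - sqC kR * omega ^- (i * val j)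
  | LE4 _, LA3 => 0
  end.

Definition Q_lt (l : rel_lt m) (e : idm_lt m) : C :=
  match l, e with
  | LA0 _, LE0 => 1
  | LA0 _, LE1 => 1
  | LA0 _, LE21 => vC - 1
  | LA0 _, LE22 => vC - 1
  | LA0 i, LE3 j => vC * omega ^+ (i * val j)
  | LA0 i, LE4 j => vC * omega ^+ (i * val j)
  | LA1, LE0 => 1
  | LA1, LE1 => 1
  | LA1, LE21 => - 1
  | LA1, LE22 => - 1
  | LA1, LE3 _ => 0
  | LA1, LE4 _ => 0
  | LA2 _, LE0 => 1
  | LA2 _, LE1 => - 1
  | LA2 _, LE21 => sqC ((vR - 1) * (vR - kR) / kR)
  | LA2 _, LE22 => - sqC ((vR - 1) * (vR - kR) / kR)
  | LA2 i, LE3 j => vC / sqC kR * omega ^+ (i * val j)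
  | LA2 i, LE4 j => - (vC / sqC kR) * omega ^+ (i * val j)
  | LA3, LE0 => 1
  | LA3, LE1 => - 1
  | LA3, LE21 => - sqC ((vR - 1) * kR / (vR - kR))
  | LA3, LE22 => sqC ((vR - 1) * kR / (vR - kR))
  | LA3, LE3 _ => 0
  | LA3, LE4 _ => 0
  end.

End Matrices.

(* Main.v *)
Require Import Defs.
From mathcomp Require Import all_boot all_order all_algebra.
From mathcomp Require Import complex mxtens reals trigo.
From mathcomp Require Import ring lra.

(** Write [n = m.+1]. Besides the [A]'s, use the block matrices [D] (all-ones
    diagonal blocks) and [X] (all-ones off-diagonal blocks), so that
    [A1 = D - sum A0] and [A3 = X - sum A2]; every product of adjacency matrices
    then follows from the products among [A0], [A2], [D] and [X]. The rows of
    [W] give the upper left block of [A2 i *m A2 j]; the lower right block needs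
    the same statement for the columns, obtained by commuting a matrix with its
    inverse, once away from the trivial character of the cyclic group and once
    for the support of [W].
    The expansions [E = Q A / N] and [A = P E] amount to Fourier inversion on
    the cyclic group, and disjointness of the supports of the [A]'s makes [P]
    and [Q] unique and inverse to each other up to the order [N]. Together with
    [A l *m E k = P k l *: E k] this yields the orthogonality of the [E]'s, hence
    commutativity, closure under products and primitivity. The original family
    [A2] is the reindexing by [i |-> - i] of the one for which the [E]'s are
    idempotent, which does not affect the scheme axioms. *)

Set Implicit Arguments.
Unset Strict Implicit.
Unset Printing Implicit Defensive.

Import Order.TTheory GRing.Theory Num.Theory.
Local Open Scope ring_scope.

(** * Recognizing an association scheme from its eigenmatrices *)

Section Eigenmatrices.
Variables (F : numFieldType) (N : nat) (L K : finType).
Variables (A : L -> 'M[F]_N) (E : K -> 'M[F]_N).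
Variables (P : K -> L -> F) (Q : L -> K -> F).

Hypothesis A_neq0 : forall l, A l != 0.
Hypothesis A_01 : forall l x y, A l x y = 0 \/ A l x y = 1.
Hypothesis A_sum : \sum_l A l = const_mx 1.

(** The entries at [(x, y)] of all the relations add up to 1. Once one of them takes the whole 1,
    the others are nonnegative with sum 0. *)
Lemma relations_disjoint l x y :
  A l x y = 1 -> forall l', l' != l -> A l' x y = 0.
Proof.
move=> Al1 l' l'l.
have := congr1 (fun M : 'M_N => M x y) A_sum.
rewrite summxE mxE (bigD1 l) //= Al1 -[RHS]addr0 => /addrI.
move/psumr_eq0P => -> // i _.
by case: (A_01 i x y) => ->.
Qed.

(** Each [A l] has an entry equal to 1, and by disjointness every other relation vanishes there.
    That position of the combination reads off [c l]. *)
Lemma relations_free (c : L -> F) :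
  \sum_l c l *: A l = 0 -> forall l, c l = 0.
Proof.
move=> cA0 l.
have [[x y] /= /eqP Axy|h] :=
  pickP (fun p : 'I_N * 'I_N => A l p.1 p.2 == 1); last first.
  case/eqP: (A_neq0 l); apply/matrixP => x y; rewrite mxE.
  by case: (A_01 l x y) => // Axy; have /= := h (x, y); rewrite Axy eqxx.
have := congr1 (fun M : 'M_N => M x y) cA0.
rewrite summxE mxE (bigD1 l) //= mxE Axy mulr1 big1 ?addr0 // => l' l'l.
by rewrite mxE (relations_disjoint Axy) // mulr0.
Qed.

Lemma relations_inj (c d : L -> F) :
  \sum_l c l *: A l = \sum_l d l *: A l -> forall l, c l = d l.
Proof.
move=> cd l; apply/eqP; rewrite -subr_eq0; apply/eqP.
apply: (relations_free (c := fun l => c l - d l)).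
under eq_bigr do rewrite scalerBl.
by rewrite sumrB cd subrr.
Qed.

Hypothesis N_gt0 : (0 < N)%N.
Hypothesis KL : #|K| = #|L|.
Hypothesis AE : first_eigenmatrix A E P.
Hypothesis EA : second_eigenmatrix A E Q.

Let N_neq0 : N%:R != 0 :> F.
Proof. by rewrite pnatr_eq0 -lt0n. Qed.

Lemma idempotent_combE (d : K -> F) :
  \sum_k d k *: E k = \sum_l (N%:R^-1 * \sum_k Q l k * d k) *: A l.
Proof.
under eq_bigr => k _ do rewrite EA scalerA scaler_sumr.
rewrite exchange_big; apply: eq_bigr => l _.
rewrite mulr_sumr scaler_suml; apply: eq_bigr => k _.
by rewrite scalerA; congr (_ *: _); ring.
Qed.

(** Expanding [A l'] in the [E k] by [P] and back in the relations by [Q] returns [A l']; freeness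
    of the relations compares the coefficients. *)
Lemma second_first_eigenmatrix l l' :
  \sum_k Q l k * P k l' = N%:R * (l == l')%:R.
Proof.
apply: (mulfI (invr_neq0 N_neq0)); rewrite mulKf //.
move: l; apply: relations_inj.
rewrite -idempotent_combE -AE (bigD1 l') //= eqxx scale1r big1 ?addr0 //.
by move=> l /negPf ->; rewrite scale0r.
Qed.

(** The other order of the product comes from square matrices: [KL] lets both kinds of labels be
    enumerated by one ordinal type, and a one-sided inverse of a square matrix is two-sided. *)
Lemma first_second_eigenmatrix k k' :
  \sum_l P k l * Q l k' = N%:R * (k == k')%:R.
Proof.
pose QM : 'M[F]_(#|L|) :=
  \matrix_(i, j) Q (enum_val i) (enum_val (cast_ord (esym KL) j)).
pose PM : 'M[F]_(#|L|) :=
  \matrix_(i, j) (N%:R^-1 * P (enum_val (cast_ord (esym KL) i)) (enum_val j)).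
have sumK (G : K -> F) :
    \sum_(j < #|L|) G (enum_val (cast_ord (esym KL) j)) = \sum_k G k.
  rewrite (reindex (fun k => cast_ord KL (enum_rank k))) /=.
    by apply: eq_bigr => j _; rewrite cast_ordK enum_rankK.
  exists (fun j => enum_val (cast_ord (esym KL) j)) => j _.
    by rewrite cast_ordK enum_rankK.
  by rewrite enum_valK cast_ordKV.
have sumL (G : L -> F) : \sum_(j < #|L|) G (enum_val j) = \sum_l G l.
  rewrite (reindex enum_rank) /=; last exact/onW_bij/enum_rank_bij.
  by apply: eq_bigr => j _; rewrite enum_rankK.
have QP1 : QM *m PM = 1%:M.
  apply/matrixP => i j; rewrite !mxE.
  under eq_bigr => h _ do rewrite !mxE mulrCA.
  rewrite -mulr_sumr (sumK (fun k => Q _ k * P k _)) second_first_eigenmatrix.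
  by rewrite mulKf // (inj_eq enum_val_inj).
have /matrixP/(_ (cast_ord KL (enum_rank k)) (cast_ord KL (enum_rank k'))) := mulmx1C QP1.
rewrite !mxE (inj_eq (@cast_ord_inj _ _ _)) (inj_eq enum_rank_inj) => <-.
rewrite -sumL mulr_sumr; apply: eq_bigr => j _.
by rewrite !mxE !cast_ordK !enum_rankK mulrA mulVKf.
Qed.

Lemma idempotents_inj (c d : K -> F) :
  \sum_k c k *: E k = \sum_k d k *: E k -> forall k, c k = d k.
Proof.
rewrite !idempotent_combE => /relations_inj cd k.
apply: (mulfI N_neq0).
(* Applying [P] to the coefficients in the relations recovers the coefficients in the [E k], up to
   the factor [N]. *)
have h (e : K -> F) : N%:R * e k = \sum_l P k l * (\sum_k' Q l k' * e k').
  under eq_bigr do rewrite mulr_sumr.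
  rewrite exchange_big (bigD1 k) //= [X in _ = _ + X]big1 ?addr0.
    under eq_bigr do rewrite mulrA.
    by rewrite -mulr_suml first_second_eigenmatrix eqxx mulr1.
  move=> k' k'k; under eq_bigr do rewrite mulrA.
  by rewrite -mulr_suml first_second_eigenmatrix eq_sym (negPf k'k) mulr0 mul0r.
rewrite !h; apply: eq_bigr => l _.
by have /(mulfI (invr_neq0 N_neq0)) -> := cd l.
Qed.

Lemma first_eigenmatrix_unique P' :
  first_eigenmatrix A E P' <-> (forall k l, P' k l = P k l).
Proof.
split=> [AE' k l|P'P l]; last by under eq_bigr do rewrite P'P.
by move: k; apply: idempotents_inj; rewrite -AE -AE'.
Qed.

Lemma second_eigenmatrix_unique Q' :
  second_eigenmatrix A E Q' <-> (forall l k, Q' l k = Q l k).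
Proof.
split=> [EA' l k|Q'Q l]; last by under eq_bigr do rewrite Q'Q.
move: l; apply: relations_inj.
apply: (scalerI (invr_neq0 N_neq0)).
by rewrite -EA -EA'.
Qed.

Hypothesis AmulE : forall l k, A l *m E k = P k l *: E k.

(** Only the left factor is expanded in relations. Each relation acts on [E k'] by a scalar, and
    these scalars add up to an entry of [P Q / N]. *)
Lemma idempotents_orthogonal k k' : E k *m E k' = (k == k')%:R *: E k'.
Proof.
rewrite {1}EA -scalemxAl mulmx_suml.
under eq_bigr do rewrite -scalemxAl AmulE scalerA mulrC.
by rewrite -scaler_suml first_second_eigenmatrix scalerA mulKf // eq_sym.
Qed.

Lemma in_span_idempotents M : in_span A M -> in_span E M.
Proof.
case=> c ->; exists (fun k => \sum_l c l * P k l).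
under eq_bigr => l _ do rewrite AE scaler_sumr.
rewrite exchange_big; apply: eq_bigr => k _.
by rewrite scaler_suml; apply: eq_bigr => l _; rewrite scalerA.
Qed.

Lemma in_span_relations M : in_span E M -> in_span A M.
Proof. by case=> d ->; rewrite idempotent_combE; eexists. Qed.

Lemma relations_mulE l l' : A l *m A l' = \sum_k (P k l * P k l') *: E k.
Proof.
rewrite [A l']AE mulmx_sumr; apply: eq_bigr => k _.
by rewrite -scalemxAr AmulE scalerA mulrC.
Qed.

Lemma relations_mul_closed l l' : in_span A (A l *m A l').
Proof. by apply: in_span_relations; rewrite relations_mulE; eexists. Qed.

Lemma relations_mulC l l' : A l *m A l' = A l' *m A l.
Proof. by rewrite !relations_mulE; under eq_bigr do rewrite mulrC. Qed.

Lemma idempotent_mul_comb k (d : K -> F) :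
  E k *m (\sum_k' d k' *: E k') = d k *: E k.
Proof.
rewrite mulmx_sumr (bigD1 k) //= big1 ?addr0.
  by rewrite -scalemxAr idempotents_orthogonal eqxx scale1r.
move=> k' k'k; rewrite -scalemxAr idempotents_orthogonal eq_sym (negPf k'k).
by rewrite scale0r scaler0.
Qed.

Lemma comb_mul_comb (c d : K -> F) :
  (\sum_k c k *: E k) *m (\sum_k d k *: E k) = \sum_k (c k * d k) *: E k.
Proof.
rewrite mulmx_suml; apply: eq_bigr => k _.
by rewrite -scalemxAl idempotent_mul_comb scalerA.
Qed.

Lemma comb_delta k : E k = \sum_k' (k' == k)%:R *: E k'.
Proof.
rewrite (bigD1 k) //= eqxx scale1r big1 ?addr0 //.
by move=> k' /negPf ->; rewrite scale0r.
Qed.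

Lemma idempotents_neq0 k : E k != 0.
Proof.
apply/eqP => Ek0; have : \sum_k' (k' == k)%:R *: E k' = \sum_k' 0 *: E k'.
  by rewrite -comb_delta Ek0; under eq_bigr do rewrite scale0r; rewrite big1.
by move/idempotents_inj/(_ k)/eqP; rewrite eqxx oner_eq0.
Qed.

(** Combinations of the [E k] multiply coefficientwise, so each coefficient is its own square. *)
Lemma comb_idempotent (c : K -> F) (f := \sum_k c k *: E k) :
  f *m f = f -> forall k, c k = 0 \/ c k = 1.
Proof.
rewrite comb_mul_comb => /idempotents_inj h k.
have /eqP := h k; rewrite -subr_eq0 -[X in _ - X]mulr1 -mulrBr mulf_eq0 subr_eq0.
by case/orP => /eqP ->; [left | right].
Qed.

(** The idempotents of the span are the combinations with coefficients 0 and 1. Multiplying one by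
    [E k] leaves 0 or [E k], which is minimality of [E k]. Conversely, a primitive idempotent has
    some coefficient 1, and its own minimality, tested on the corresponding [E k], makes them
    equal. *)
Lemma eigenmatrices_primitive_idempotents k0 :
  E k0 = N%:R^-1 *: const_mx 1 -> primitive_idempotents k0 A E.
Proof.
have idem k : E k *m E k = E k.
  by rewrite idempotents_orthogonal eqxx scale1r.
have span k : in_span A (E k).
  by apply: in_span_relations; rewrite comb_delta; eexists.
move=> Ek0; split=> // [k k' Ekk'|k|e [eA e0 ee emin]].
- apply/eqP/contraT => kk'; case/eqP: (idempotents_neq0 k').
  by rewrite -{1}idem -{1}Ekk' idempotents_orthogonal (negPf kk') scale0r.
- split=> // [|f /in_span_idempotents[c fE]]; first exact: idempotents_neq0.
  rewrite fE => /comb_idempotent c01; rewrite idempotent_mul_comb => <-.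
  by case: (c01 k) => ->; [left; rewrite scale0r | right; rewrite scale1r].
- have [c eE] := in_span_idempotents eA.
  have c01 : forall k, c k = 0 \/ c k = 1 by apply: comb_idempotent; rewrite -eE.
  have [k /eqP ck|h] := pickP (fun k => c k == 1); last first.
    case/eqP: e0; rewrite eE big1 // => k _.
    by case: (c01 k) => ck; [rewrite ck scale0r | have := h k; rewrite ck eqxx].
  exists k; case: (emin (E k)) => //.
    rewrite eE (comb_delta k) comb_mul_comb.
    by apply: eq_bigr => k' _; case: eqP => [->|_]; rewrite ?ck ?mulr0 ?mulr1.
  by move=> Ek; have := idempotents_neq0 k; rewrite Ek eqxx.
Qed.

End Eigenmatrices.

(** The axioms see only the collection of matrices and the label of the identity. This carries the
    scheme from one orientation of the [A2] family to the other. *)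
Lemma comm_assoc_scheme_reindex (F : fieldType) (N : nat) (L : finType)
    (A A' : L -> 'M[F]_N) (s : L -> L) (l0 : L) :
  involutive s -> s l0 = l0 -> (forall l, A' l = A (s l)) ->
  comm_assoc_scheme l0 A -> comm_assoc_scheme l0 A'.
Proof.
move=> sK sl0 A'A [An0 [A01 [A1 [AJ [AT [Amul AC]]]]]].
have sumA' c : \sum_l c l *: A' l = \sum_l c (s l) *: A l.
  rewrite [RHS](reindex_inj (inv_inj sK)).
  by apply: eq_bigr => l _; rewrite A'A sK.
split=> [l|]; first by rewrite A'A.
split=> [l x y|]; first by rewrite A'A.
split; first by rewrite A'A sl0.
split.
  rewrite -AJ [RHS](reindex_inj (inv_inj sK)).
  by apply: eq_bigr => l _; rewrite A'A.
split=> [l ll0|].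
  have [|l' l'l0 lT] := AT (s l); first by rewrite -sl0 (inj_eq (inv_inj sK)).
  exists (s l'); first by rewrite -sl0 (inj_eq (inv_inj sK)).
  by rewrite !A'A sK.
split=> l l'; rewrite !A'A //.
have [c ->] := Amul (s l) (s l').
exists (fun l => c (s l)); rewrite sumA'.
by apply: eq_bigr => j _; rewrite sK.
Qed.

(** * The root of unity *)

Section RootOfUnity.
Variables (R : realType) (m : nat).
Local Notation n := (m.+1).
Local Notation w := (omega R m).

(** De Moivre's formula. *)
Lemma omegaX t : w ^+ t =
  Complex (cos (t%:R * (2 * pi / n%:R))) (sin (t%:R * (2 * pi / n%:R))).
Proof.
rewrite /omega; set a := 2 * pi / n%:R.
elim: t => [|t IHt]; first by rewrite expr0 mul0r cos0 sin0.
rewrite exprSr IHt -[t.+1%:R]natr1 mulrDl mul1r cosD sinD.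
by congr Complex; rewrite addrC.
Qed.

Lemma omegaXn : w ^+ n = 1.
Proof.
rewrite omegaX mulrC divfK ?pnatr_eq0 // mulrC mulr_natr.
by rewrite cos2pi sin2pi.
Qed.

(** Put [y = t pi / n], strictly between 0 and [pi]. If [cos (2 y)] were 1, then [sin y] would be 0,
    but it is positive. Thus [omega] is a primitive [n]-th root of unity. *)
Lemma omegaX_neq1 t : (0 < t < n)%N -> w ^+ t != 1.
Proof.
case/andP=> t0 tn; rewrite omegaX; apply/eqP => -[] cos1 _.
pose y : R := t%:R * pi / n%:R.
have n0 : 0 < n%:R :> R by rewrite ltr0n.
have y0 : 0 < y < pi.
  rewrite /y divr_gt0 ?mulr_gt0 ?ltr0n ?pi_gt0 //=.
  by rewrite ltr_pdivrMr // mulrC ltr_pM2l ?pi_gt0 // ltr_nat.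
have e : t%:R * (2 * pi / n%:R) = y *+ 2.
  by rewrite /y -mulr_natr; ring.
have := sin_gt0_pi y0; move: cos1; rewrite e cos_mulr2n.
have := cos2Dsin2 y; nra.
Qed.

Lemma omega_neq0 : w != 0.
Proof.
by apply/eqP => w0; have := omegaXn; rewrite w0 expr0n /= => /esym/eqP; rewrite oner_eq0.
Qed.

Lemma omegaX_inj (i j : 'I_n) : w ^+ i = w ^+ j -> i = j.
Proof.
wlog ij : i j / (i <= j)%N => [h wij|].
  by case: (leqP i j) => [|/ltnW] ij; [exact: h | symmetry; exact: h].
move/eqP; rewrite -(subnK ij) exprD -{1}[w ^+ i]mul1r.
rewrite (inj_eq (mulIf (expf_neq0 _ omega_neq0))) eq_sym => wji.
apply/val_inj/eqP; rewrite eqn_leq ij /= -subn_eq0.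
apply: contraLR wji; rewrite -lt0n => ji; apply: omegaX_neq1.
by rewrite ji (leq_ltn_trans (leq_subr _ _)).
Qed.

Lemma sum_expr_eq0 (F : idomainType) (z : F) t :
  z != 1 -> z ^+ t = 1 -> \sum_(i < t) z ^+ i = 0.
Proof.
move=> z1 zt; apply/eqP; move: (subrX1 z t); rewrite zt subrr => /esym/eqP.
by rewrite mulf_eq0 subr_eq0 (negPf z1).
Qed.

(** The sum [j + l] in ['I_n] is reduced modulo [n], which the power does not notice because
    [w ^+ n = 1]. *)
Lemma omegaXM_add (i j l : 'I_n) :
  w ^+ (i * (j + l)%R) = w ^+ (i * j) * w ^+ (i * l).
Proof.
rewrite -exprD -mulnDr !exprM; apply: expr_mod.
by rewrite -exprM mulnC exprM omegaXn expr1n.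
Qed.

Lemma omegaXM_sub (i j l : 'I_n) :
  w ^+ (i * (j - l)%R) = w ^+ (i * j) / w ^+ (i * l).
Proof.
apply: (mulIf (expf_neq0 (i * l) omega_neq0)).
by rewrite divfK ?expf_neq0 ?omega_neq0 // -omegaXM_add subrK.
Qed.

Lemma sum_omega_row (i : 'I_n) : i != 0 -> \sum_(j < n) w ^+ (i * j) = 0.
Proof.
move=> i0; under eq_bigr do rewrite exprM.
apply: sum_expr_eq0; last by rewrite -exprM mulnC exprM omegaXn expr1n.
by apply: omegaX_neq1; rewrite ltn_ord andbT lt0n.
Qed.

(** A geometric sum with ratio [w ^+ j / w ^+ i], which is an [n]-th root of unity and equals 1 only
    for [i = j]. *)
Lemma sum_omega_delta (i j : 'I_n) :
  \sum_(l < n) w ^- (i * l) * w ^+ (l * j) = n%:R * (i == j)%:R.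
Proof.
have e (l : 'I_n) : w ^- (i * l) * w ^+ (l * j) = (w ^+ j / w ^+ i) ^+ l.
  by rewrite exprMn exprVn -!exprM mulrC mulnC.
under eq_bigr do rewrite e.
case: (eqVneq i j) => [->|ij].
  rewrite divff ?expf_neq0 ?omega_neq0 //; under eq_bigr do rewrite expr1n.
  by rewrite sumr_const card_ord mulr1.
rewrite mulr0; apply: sum_expr_eq0.
  apply: contra ij => /eqP h; apply/eqP/esym/omegaX_inj.
  by rewrite -[RHS]mul1r -h divfK ?expf_neq0 ?omega_neq0.
by rewrite exprMn exprVn -!exprM !(mulnC _ n) !exprM omegaXn !expr1n divr1.
Qed.

End RootOfUnity.

(** * Tensor products and circulants *)

Section Tensor.
Variables (F : comPzRingType) (p q r s : nat).
Implicit Types M : 'M[F]_(p, q).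

Lemma tensmx_suml (I : finType) (M : I -> 'M[F]_(p, q)) (M' : 'M[F]_(r, s)) :
  (\sum_i M i) *t M' = \sum_i M i *t M'.
Proof.
apply/matrixP => x y; rewrite !mxE !summxE mulr_suml.
by apply: eq_bigr => i _; rewrite !mxE.
Qed.

Lemma tensmx_sumr (I : finType) M (M' : I -> 'M[F]_(r, s)) :
  M *t (\sum_i M' i) = \sum_i M *t M' i.
Proof.
apply/matrixP => x y; rewrite !mxE !summxE mulr_sumr.
by apply: eq_bigr => i _; rewrite !mxE.
Qed.

Lemma tensmxBr M (M1 M2 : 'M[F]_(r, s)) : M *t (M1 - M2) = M *t M1 - M *t M2.
Proof. by apply/matrixP => x y; rewrite !mxE mulrBr. Qed.

Lemma tensmxDr M (M1 M2 : 'M[F]_(r, s)) : M *t (M1 + M2) = M *t M1 + M *t M2.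
Proof. by apply/matrixP => x y; rewrite !mxE mulrDr. Qed.

Lemma tensmxZr M a (M' : 'M[F]_(r, s)) : M *t (a *: M') = a *: (M *t M').
Proof. by apply/matrixP => x y; rewrite !mxE mulrCA. Qed.

Lemma tensmx_const : const_mx 1 *t const_mx 1 = const_mx 1 :> 'M[F]_(p * r, q * s).
Proof. by apply/matrixP => x y; rewrite !mxE mulr1. Qed.

End Tensor.

Lemma tensmx1 (F : comPzRingType) p q : 1%:M *t 1%:M = 1%:M :> 'M[F]_(p * q).
Proof.
apply/matrixP => x y.
case: (mxtens_indexP x) => i j; case: (mxtens_indexP y) => i' j'.
rewrite tensmxE !mxE -natrM mulnb (inj_eq (can_inj (@mxtens_indexK _ _))).
by rewrite xpair_eqE.
Qed.

Lemma mulmx_constr (F : pzSemiRingType) p q r (M : 'M[F]_(p, q)) (c : F) :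
  (forall x, \sum_y M x y = c) -> M *m const_mx 1 = const_mx c :> 'M_(p, r).
Proof.
move=> Mc; apply/matrixP => x y; rewrite !mxE -[RHS](Mc x).
by apply: eq_bigr => z _; rewrite !mxE mulr1.
Qed.

Lemma mulmx_const (F : pzSemiRingType) p q r :
  (const_mx 1 : 'M[F]_(p, q)) *m (const_mx 1 : 'M_(q, r)) = q%:R *: const_mx 1.
Proof.
rewrite (@mulmx_constr _ _ _ _ _ q%:R) => [|x].
  by apply/matrixP => x y; rewrite !mxE mulr1.
by under eq_bigr do rewrite mxE; rewrite sumr_const card_ord.
Qed.

Section Circulant.
Variables (R : realType) (m : nat).
Local Notation n := (m.+1).
Local Notation Cp i := (Cmx R m ^+ nat_of_ord i).
Local Notation J := (Jmx R).

Lemma circ_deltaM (i j : 'I_n) :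
  circ (fun l => (l == i)%:R : R[i]) *m circ (fun l => (l == j)%:R) =
  circ (fun l => (l == i + j)%:R).
Proof.
apply/matrixP => a b; rewrite !mxE (bigD1 (a + i)) //= big1 ?addr0 => [|c cai].
  rewrite !mxE [a + i]addrC addrK eqxx mul1r; congr (_%:R); congr (nat_of_bool _).
  by rewrite opprD addrA [_ - i - a]addrAC subr_eq [j + i]addrC.
by rewrite !mxE subr_eq addrC (negPf cai) mul0r.
Qed.

Lemma CmxX (i : 'I_n) : Cp i = circ (fun l => (l == i)%:R).
Proof.
(* The induction runs over all natural exponents, with the shift reduced modulo [n]. *)
have h t : Cmx R m ^+ t = circ (fun l => (l == inZp t :> 'I_n)%:R).
  elim: t => [|t IHt].
    apply/matrixP => a b; rewrite expr0 !mxE eq_sym -subr_eq0.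
    by congr ((_ == _)%:R); apply: val_inj; rewrite /= mod0n.
  rewrite exprSr IHt; apply: etrans (circ_deltaM _ _) _.
  congr (circ _); apply: boolp.funext => l; congr ((_ == _)%:R).
  by apply: val_inj; rewrite /= modnDml modnDmr addn1.
by rewrite h valZpK.
Qed.

Lemma CmxXE (i a b : 'I_n) : (Cp i) a b = (b - a == i)%:R.
Proof. by rewrite CmxX mxE. Qed.

Lemma CmxXM (i j : 'I_n) : Cp i *m Cp j = Cp (i + j).
Proof. by rewrite !CmxX circ_deltaM. Qed.

Lemma CmxXT (i : 'I_n) : (Cp i)^T = Cp (- i).
Proof.
apply/matrixP => a b; rewrite mxE !CmxXE.
by rewrite -opprB eqr_oppLR.
Qed.

Lemma sum_CmxX : \sum_(i < n) Cp i = J n.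
Proof.
apply/matrixP => a b; rewrite summxE [RHS]mxE (bigD1 (b - a)) // big1 ?addr0.
  by rewrite CmxXE eqxx /= addr0.
by move=> i /= ib; rewrite CmxXE eq_sym (negPf ib).
Qed.

Lemma trJ p : (J p)^T = J p.
Proof. by rewrite trmx_const. Qed.

Lemma JJ p : J p *m J p = p%:R *: J p.
Proof. exact: mulmx_const. Qed.

Lemma tensJJ p : J n *t J p = J (n * p).
Proof. exact: tensmx_const. Qed.

End Circulant.

(** * Block circulant matrices *)

Section BlockCirculant.
Variables (R : realType) (m v : nat).
Local Notation n := (m.+1).
Local Notation Cp i := (Cmx R m ^+ nat_of_ord i).
Implicit Types f g : 'I_n -> 'M[R[i]]_v.

(** The block in position [(a, b)] is [f (b - a)]. These matrices represent the group algebra of the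
    cyclic group with coefficients in ['M_v], so their products are convolutions. *)
Definition bcirc f : 'M[R[i]]_(n * v) := \sum_(j < n) Cp j *t f j.

Lemma bcircE f a x b y :
  bcirc f (mxtens_index (a, x)) (mxtens_index (b, y)) = f (b - a) x y.
Proof.
rewrite /bcirc summxE (bigD1 (b - a)) // big1 => [|i].
  by rewrite tensmxE CmxXE eqxx mul1r /= addr0.
by move=> /= ib; rewrite tensmxE CmxXE eq_sym (negPf ib) mul0r.
Qed.

Lemma eq_bcirc f g : (forall j, f j = g j) -> bcirc f = bcirc g.
Proof. by move=> fg; apply: eq_bigr => j _; rewrite fg. Qed.

Lemma bcirc_inj f g : bcirc f = bcirc g -> forall j, f j = g j.
Proof.
move=> fg j; apply/matrixP => x y.
by have := bcircE f 0 x j y; rewrite fg bcircE subr0.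
Qed.

Lemma bcircM f g :
  bcirc f *m bcirc g = bcirc (fun s => \sum_j f j *m g (s - j)).
Proof.
rewrite /bcirc mulmx_suml.
under eq_bigr => j _.
  rewrite mulmx_sumr (reindex_inj (addIr (- j))).
  under eq_bigr => s _ do rewrite tensmx_mul CmxXM addrC subrK.
  over.
rewrite exchange_big /=; apply: eq_bigr => s _.
by rewrite tensmx_sumr.
Qed.

Lemma bcircD f g : bcirc f + bcirc g = bcirc (fun j => f j + g j).
Proof. by rewrite -big_split; apply: eq_bigr => j _; rewrite tensmxDr. Qed.

Lemma bcircB f g : bcirc f - bcirc g = bcirc (fun j => f j - g j).
Proof. by rewrite -sumrB; apply: eq_bigr => j _; rewrite tensmxBr. Qed.

Lemma bcircZ a f : a *: bcirc f = bcirc (fun j => a *: f j).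
Proof. by rewrite scaler_sumr; apply: eq_bigr => j _; rewrite tensmxZr. Qed.

Lemma bcirc_sum (I : finType) (f : I -> 'I_n -> 'M[R[i]]_v) :
  \sum_i bcirc (f i) = bcirc (fun j => \sum_i f i j).
Proof.
by rewrite exchange_big; apply: eq_bigr => j _; rewrite tensmx_sumr.
Qed.

Lemma bcircT f : (bcirc f)^T = bcirc (fun j => (f (- j))^T).
Proof.
transitivity (\sum_j (Cp j *t f j)^T); first exact: linear_sum.
rewrite (reindex_inj oppr_inj).
by apply: eq_bigr => j _; rewrite trmx_tens CmxXT opprK.
Qed.

Lemma bcirc_const M : Jmx R n *t M = bcirc (fun _ => M).
Proof. by rewrite -sum_CmxX tensmx_suml. Qed.

Lemma bcirc_J : Jmx R (n * v) = bcirc (fun _ => Jmx R v).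
Proof. by rewrite -tensJJ bcirc_const. Qed.

Lemma bcirc_delta i M : Cp i *t M = bcirc (fun j => (j == i)%:R *: M).
Proof.
rewrite /bcirc (bigD1 i) //= eqxx scale1r big1 ?addr0 // => j /negPf ->.
by rewrite scale0r tensmx0.
Qed.

Lemma bcirc_1 : 1%:M = bcirc (fun j => (j == 0)%:R *: 1%:M).
Proof. by rewrite -bcirc_delta expr0 tensmx1. Qed.

Lemma sum_delta_scale i f : \sum_j (j == i)%:R *: f j = f i.
Proof.
rewrite (bigD1 i) //= eqxx scale1r big1 ?addr0 // => j /negPf ->.
by rewrite scale0r.
Qed.

End BlockCirculant.

(** * Balanced generalized weighing matrices *)

Section BGW.
Variables (R : realType) (m v k lam : nat) (W : 'M[option 'I_m.+1]_v).
Local Notation n := (m.+1).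
Local Notation C := R[i].
Local Notation B := (Bmx R W).
Local Notation J := (Jmx R v).
Local Notation kC := (k%:R : C).
Local Notation vC := (v%:R : C).
Local Notation nC := (n%:R : C).
Local Notation lC := (lam%:R : C).

(** The incidence matrix of the support of [W]. *)
Definition Nmx : 'M[C]_v := \sum_j B j.

Lemma NmxE x y : Nmx x y = (W x y != None)%:R.
Proof.
rewrite summxE; case Wxy: (W x y) => [a|].
  rewrite (bigD1 a) //= big1 ?addr0 => [|i ia]; rewrite mxE Wxy ?eqxx //.
  by rewrite (inj_eq (@Some_inj _)) eq_sym (negPf ia).
by rewrite big1 // => i _; rewrite mxE Wxy.
Qed.

Lemma trNmx : Nmx^T = \sum_j (B j)^T.
Proof. exact: linear_sum. Qed.

(** The coefficient at [g] of the product of [W] with its conjugate transpose over the group ring.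
    Its entry at [(x, z)] counts the columns where row [x] minus row [z] is [g]; [col_gram] does
    this for the columns of [W], as second column minus first. *)
Definition row_gram (g : 'I_n) : 'M[C]_v := \sum_h B h *m (B (h - g))^T.
Definition col_gram (g : 'I_n) : 'M[C]_v := \sum_h (B (h - g))^T *m B h.

Lemma sum_row_gram : \sum_g row_gram g = Nmx *m Nmx^T.
Proof.
rewrite exchange_big trNmx mulmx_suml; apply: eq_bigr => h _.
rewrite mulmx_sumr [RHS](reindex_inj (inj_comp (addrI h) oppr_inj)).
by apply: eq_bigr.
Qed.

Lemma sum_col_gram : \sum_g col_gram g = Nmx^T *m Nmx.
Proof.
rewrite exchange_big trNmx mulmx_sumr; apply: eq_bigr => h _.
rewrite mulmx_suml [RHS](reindex_inj (inj_comp (addrI h) oppr_inj)).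
by apply: eq_bigr.
Qed.

Lemma row_gram_card g x z : row_gram g x z =
  #|[set l | match W x l, W z l with
             | Some a, Some b => a - b == g :> 'I_n
             | _, _ => false
             end]|%:R.
Proof.
rewrite summxE; under eq_bigr do rewrite mxE.
rewrite exchange_big -sum1_card natr_sum [RHS]big_mkcond /=; apply: eq_bigr => y _.
rewrite inE; under eq_bigr do rewrite !mxE.
case Wxy: (W x y) => [a|]; last by rewrite big1 // => h _; rewrite mul0r.
rewrite (bigD1 a) //= eqxx mul1r big1 ?addr0 => [|h ha]; last first.
  by rewrite (inj_eq (@Some_inj _)) eq_sym (negPf ha) mul0r.
case: (W z y) => [b|] //; rewrite (inj_eq (@Some_inj _)).
by rewrite eq_sym subr_eq addrC -subr_eq; case: eqP.
Qed.

Hypothesis hW : is_BGW k lam W.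

(** Off the diagonal this is the balance condition. On the diagonal every one of the [k] differences
    is 0. *)
Lemma row_gramE g :
  row_gram g = (kC * (g == 0)%:R) *: 1%:M + (lC / nC) *: (J - 1%:M).
Proof.
have [hk hl] := hW; apply/matrixP => x z; rewrite row_gram_card !mxE.
case: (eqVneq x z) => [<-|xz].
  rewrite subrr mulr0 addr0 mulr1 -(hk x) -natrM; congr (_%:R).
  case: eqVneq => [->|g0]; rewrite ?muln1 ?muln0; last first.
    apply: eq_card0 => l; rewrite !inE; case: (W x l) => // a.
    by rewrite subrr eq_sym (negPf g0).
  by apply: eq_card => l; rewrite !inE; case: (W x l) => // a; rewrite subrr eqxx.
rewrite mulr0 add0r subr0 mulr1 -(hl x z xz g) natrM mulfK //.
by rewrite pnatr_eq0.
Qed.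

Lemma NNT : Nmx *m Nmx^T = (kC - lC) *: 1%:M + lC *: J.
Proof.
rewrite -sum_row_gram; under eq_bigr do rewrite row_gramE.
rewrite big_split /= -scaler_suml -mulr_sumr sumr_const card_ord.
rewrite (bigD1 0) //= ?eqxx big1 ?addr0 ?mulr1 => [|i /negPf ->] //.
rewrite -[X in _ + X = _]scaler_nat scalerA mulrC divfK ?pnatr_eq0 //.
by apply/matrixP => x y; rewrite !mxE; ring.
Qed.

Lemma NJ : Nmx *m J = kC *: J.
Proof.
have [hk _] := hW; rewrite (@mulmx_constr _ _ _ _ _ kC) => [|x].
  by apply/matrixP => x y; rewrite !mxE mulr1.
under eq_bigr do rewrite NmxE.
rewrite -(hk x) -sum1_card natr_sum [RHS]big_mkcond /=.
by apply: eq_bigr => y _; rewrite inE; case: eqP.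
Qed.

(* With [U], [L] the off-diagonal blocks of [A2 0] and [p] the projection
   [n^-1 J_n *t I_v], the matrices [U (1 - p) + p] and [L (1 - p) + k p] are
   inverse to each other up to the factor [k]; commuting them transfers the
   inner products of the rows of [W] to its columns, up to the trivial
   character. *)
Lemma col_gram_centered g : (0 < k)%N ->
  col_gram g - nC^-1 *: (Nmx^T *m Nmx) = kC *: (((g == 0)%:R - nC^-1) *: 1%:M).
Proof.
move=> hk; have k0 : kC != 0 by rewrite pnatr_eq0 -lt0n.
have n0 : nC != 0 by rewrite pnatr_eq0.
pose U := bcirc (fun j => B j); pose L := bcirc (fun j => (B (- j))^T).
pose p : 'M[C]_(n * v) := bcirc (fun _ => nC^-1 *: 1%:M).
have UL : U *m L = bcirc row_gram.
  rewrite bcircM; apply: eq_bcirc => s; apply: eq_bigr => j _.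
  by rewrite opprB.
have LU : L *m U = bcirc col_gram.
  rewrite bcircM; apply: eq_bcirc => s.
  rewrite [RHS](reindex_inj (inj_comp (addrI s) oppr_inj)).
  by apply: eq_bigr => j _ /=; rewrite addrAC subrr sub0r.
have fp (f : 'I_n -> 'M[C]_v) : bcirc f *m p = bcirc (fun _ => nC^-1 *: \sum_j f j).
  rewrite bcircM; apply: eq_bcirc => s; rewrite scaler_sumr.
  by apply: eq_bigr => j _; rewrite -scalemxAr mulmx1.
have pf (f : 'I_n -> 'M[C]_v) : p *m bcirc f = bcirc (fun _ => nC^-1 *: \sum_j f j).
  rewrite bcircM; apply: eq_bcirc => s; rewrite scaler_sumr.
  rewrite [RHS](reindex_inj (inj_comp (addrI s) oppr_inj)).
  by apply: eq_bigr => j _; rewrite -scalemxAl mul1mx.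
have pp : p *m p = p.
  rewrite fp; apply: eq_bcirc => s; rewrite sumr_const card_ord.
  by rewrite -[X in _ *: X]scaler_nat scalerA mulVf // scale1r.
have Up : U *m p = p *m U by rewrite fp pf.
have Lp : L *m p = p *m L by rewrite fp pf.
pose q := 1%:M - p.
have pq : p *m q = 0 by rewrite mulmxBr mulmx1 pp subrr.
have qp : q *m p = 0 by rewrite mulmxBl mul1mx pp subrr.
have qq : q *m q = q by rewrite mulmxBl mul1mx pq subr0.
(* Multiplying by [q] subtracts the average over the group. The [J] terms of [row_gramE] do not
   depend on the group element, so they disappear and only the scalar [k] survives. *)
have ULq : U *m L *m q = kC *: q.
  rewrite UL mulmxBr mulmx1 fp /q [1%:M]bcirc_1 !bcircB bcircZ; apply: eq_bcirc => j.
  rewrite sum_row_gram NNT row_gramE.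
  by apply/matrixP => x y; rewrite !mxE; ring.
have qE : q = 1%:M - p by [].
clearbody q.
(* The complementary projections [q] and [p] annihilate each other and commute with [M'], so the two
   parts multiply separately. *)
have split (M M' : 'M[C]_(n * v)) a b : M' *m p = p *m M' ->
    (M *m q + a *: p) *m (M' *m q + b *: p) = M *m M' *m q + (a * b) *: p.
  move=> M'p; have qM' : q *m M' = M' *m q.
    by rewrite qE mulmxBl mulmxBr mul1mx mulmx1 M'p.
  have -> : (M *m q + a *: p) *m (M' *m q + b *: p) =
      M *m (q *m M') *m q + b *: (M *m (q *m p)) +
      (a *: (p *m M' *m q) + (a * b) *: (p *m p)).
    by rewrite mulmxDl !mulmxDr -!scalemxAl -!scalemxAr scalerA !mulmxA.
  rewrite qM' qp mulmx0 scaler0 addr0 -M'p -[M' *m p *m q]mulmxA.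
  rewrite pq mulmx0 scaler0 add0r pp.
  by rewrite -!mulmxA qq.
have : (U *m q + 1 *: p) *m (kC^-1 *: (L *m q + kC *: p)) = 1%:M.
  rewrite -scalemxAr split // mul1r ULq -scalerDr qE subrK.
  by rewrite scalerA mulVf // scale1r.
move/mulmx1C; rewrite -scalemxAl split // mulr1.
move/(congr1 (fun M => kC *: M)); rewrite scalerA mulfV // scale1r => h.
have {}h : L *m U *m q = kC *: q by rewrite {2}qE scalerBr -h addrK.
move: h; rewrite LU qE mulmxBr mulmx1 fp [1%:M]bcirc_1.
rewrite !bcircB bcircZ => /bcirc_inj/(_ g).
by rewrite sum_col_gram -scalerBl.
Qed.

(** An entry of [W] cannot be both [h - g] and [h]. *)
Lemma col_gram_diag g y : g != 0 -> col_gram g y y = 0.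
Proof.
move=> g0; rewrite summxE big1 // => h _; rewrite mxE big1 // => x _.
rewrite !mxE; case: (W x y) => [a|]; last by rewrite mul0r.
rewrite !(inj_eq (@Some_inj _)); case: (eqVneq a h) => [->|_]; last by rewrite mulr0.
rewrite -[X in X == _]subr0 (inj_eq (addrI h)) (inj_eq oppr_inj) eq_sym.
by rewrite (negPf g0) mul0r.
Qed.

Lemma NTN_diag y : (Nmx^T *m Nmx) y y = \sum_x Nmx x y.
Proof.
rewrite mxE; apply: eq_bigr => x _.
by rewrite [_^T _ _]mxE NmxE; case: eqP; rewrite ?mulr0 ?mulr1.
Qed.

Lemma mulJmx (M : 'M[C]_v) c : (forall y, \sum_x M x y = c) -> J *m M = c *: J.
Proof.
move=> Mc; apply/matrixP => x y; rewrite !mxE mulr1 -(Mc y).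
by apply: eq_bigr => z _; rewrite mxE mul1r.
Qed.

(** For [n > 1] there is a nonzero group element, here [ord_max], at which the diagonal of
    [col_gram] vanishes. The diagonal of [col_gram_centered] then says that [Nmx^T *m Nmx] has
    diagonal [k], and this diagonal consists of the column sums of [Nmx]. *)
Lemma JN_cyclic : (0 < k)%N -> (0 < m)%N -> J *m Nmx = kC *: J.
Proof.
move=> hk hm; apply: mulJmx => y; rewrite -NTN_diag.
have n0 : nC != 0 by rewrite pnatr_eq0.
have g0 : (ord_max : 'I_n) != 0 by rewrite -val_eqE /= -lt0n.
move: (Nmx^T *m Nmx) (col_gram_centered ord_max hk) => M /matrixP/(_ y y).
rewrite mxE col_gram_diag // !mxE (negPf g0) !eqxx => h.
apply: (mulfI (invr_neq0 n0)); apply: oppr_inj.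
by move: h; rewrite !add0r mulr1 mulrN [kC * _]mulrC => <-.
Qed.

Hypothesis hv : (1 < v)%N.
Hypothesis hk : (0 < k)%N.
Hypothesis hkv : (k <= v)%N.
Hypothesis hnd : n = 1%N -> (k < v)%N -> (lam < k)%N.

Let i0 : 'I_v := Ordinal (ltnW hv).

Let J_inj (a b : C) : a *: J = b *: J -> a = b.
Proof. by move/matrixP/(_ i0 i0); rewrite !mxE !mulr1. Qed.

Lemma JNT : J *m Nmx^T = kC *: J.
Proof. by rewrite -[J in LHS]trJ -trmx_mul NJ linearZ /= trJ. Qed.

(** The product [J *m Nmx *m Nmx^T] is evaluated in two ways: factor by factor, and through
    [NNT]. *)
Lemma JNNT : J *m Nmx = kC *: J -> kC * kC = kC - lC + lC * vC.
Proof.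
move=> JN; apply: J_inj.
rewrite -scalerA -JNT scalemxAl -JN -mulmxA NNT mulmxDr -!scalemxAr JJ mulmx1.
by rewrite scalerA -scalerDl.
Qed.

Lemma Nmx_full : k = v -> Nmx = J.
Proof.
move=> kv; apply/matrixP => x y; rewrite NmxE mxE.
have /eqP : [set l | W x l != None] = setT.
  by apply/eqP; rewrite eqEcard subsetT cardsT card_ord hW.1 kv leqnn.
by rewrite eqEsubset => /andP[_ /subsetP/(_ y)]; rewrite !inE => ->.
Qed.

(** This makes [Nmx *m Nmx^T - lam J] an invertible scalar matrix. For [n > 1], [lam = k] would turn
    [JNNT] into [k * k = k * v], against [k < v]. For [n = 1] it is the hypothesis [hnd], which
    rules out that all rows of [W] have the same support. *)
Lemma lam_neq_k : (k < v)%N -> kC - lC != 0.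
Proof.
move=> ltkv; rewrite subr_eq0 eqr_nat; case: (posnP m) => m0.
  by apply: contraTneq (hnd (congr1 S m0) ltkv) => ->; rewrite ltnn.
apply: contraTneq ltkv => kl; have := JNNT (JN_cyclic hk m0).
rewrite -kl subrr add0r -!natrM => /eqP; rewrite eqr_nat eqn_pmul2l // => /eqP <-.
by rewrite ltnn.
Qed.

(* For [k < v] the relation [N (N^T - (lam / k) J) = (k - lam) I] commutes, and
   symmetry of [N^T N] then forces the column sums of [N] to be constant. *)
Lemma col_design :
  J *m Nmx = kC *: J /\ Nmx^T *m Nmx = (kC - lC) *: 1%:M + lC *: J.
Proof.
have k0 : kC != 0 by rewrite pnatr_eq0 -lt0n.
have v0 : vC != 0 by rewrite pnatr_eq0 -lt0n ltnW.
move: hkv; rewrite leq_eqVlt => /orP[/eqP kv|ltkv].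
  have := NNT; rewrite Nmx_full // trJ JJ kv => h; split=> //.
have kl := lam_neq_k ltkv.
have : Nmx *m ((kC - lC)^-1 *: (Nmx^T - (lC / kC) *: J)) = 1%:M.
  rewrite -scalemxAr mulmxBr -scalemxAr NNT NJ scalerA divfK // addrK.
  by rewrite scalerA mulVf // scale1r.
move/mulmx1C; rewrite -scalemxAl mulmxBl -scalemxAl.
move/(congr1 (fun M => (kC - lC) *: M)); rewrite scalerA mulfV // scale1r => h.
have {}h : Nmx^T *m Nmx = (kC - lC) *: 1%:M + (lC / kC) *: (J *m Nmx).
  by rewrite -h subrK.
(* If [lam = 0] the term with [J *m Nmx] is absent, and the column sums are read off the diagonal of
   [Nmx^T *m Nmx]. *)
have [l0|l0] := eqVneq lC 0.
  have NTN : Nmx^T *m Nmx = (kC - lC) *: 1%:M + lC *: J.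
    by rewrite h l0 mul0r !scale0r.
  split=> //; apply: mulJmx => y; rewrite -NTN_diag NTN !mxE eqxx l0.
  by rewrite subr0 mul0r addr0 mulr1.
(* Since [Nmx^T *m Nmx] is symmetric, so is [J *m Nmx]. Comparing entries of the two sides makes all
   column sums equal, and multiplying by [J] on the right identifies their common value with the row
   sum [k]. *)
have JNC : J *m Nmx = Nmx^T *m J.
  apply: (scalerI (mulf_neq0 l0 (invr_neq0 k0))).
  apply: (addrI ((kC - lC) *: 1%:M)); rewrite -h -[RHS]trmxK.
  rewrite linearD /= !linearZ /= trmx_mul trmxK trJ trmx1 -h.
  by rewrite trmx_mul trmxK.
have JN : J *m Nmx = kC *: J.
  have e y : \sum_x Nmx x y = \sum_x Nmx x i0.
    have /matrixP/(_ i0 y) := JNC; rewrite !mxE.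
    under eq_bigr do rewrite mxE mul1r.
    by move=> ->; apply: eq_bigr => z _; rewrite !mxE mulr1.
  have JN := mulJmx e; rewrite JN; congr (_ *: _).
  have := congr1 (mulmx J) NJ; rewrite mulmxA JN -scalemxAl -scalemxAr JJ !scalerA.
  by move/J_inj/(mulIf v0).
by split=> //; rewrite h JN scalerA divfK.
Qed.

Lemma JN : J *m Nmx = kC *: J. Proof. exact: col_design.1. Qed.

Lemma NTJ : Nmx^T *m J = kC *: J.
Proof. by rewrite -[J in LHS]trJ -trmx_mul JN linearZ /= trJ. Qed.

Lemma param_eq : kC * kC = kC - lC + lC * vC.
Proof. exact: JNNT JN. Qed.

(** Adds back the average over the group, which [col_gram_centered] removed and [col_design]
    computes. *)
Lemma col_gramE g :
  col_gram g = (kC * (g == 0)%:R) *: 1%:M + (lC / nC) *: (J - 1%:M).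
Proof.
have n0 : nC != 0 by rewrite pnatr_eq0.
apply: (addIr (- (nC^-1 *: (Nmx^T *m Nmx)))); rewrite col_gram_centered //.
rewrite col_design.2.
by apply/matrixP => x y; rewrite !mxE; ring.
Qed.

(** * The adjacency matrices *)

Lemma sum_block_mx (I : finType) p q r s
    (f : I -> 'M[C]_(p, r)) g h (l : I -> 'M[C]_(q, s)) :
  \sum_i block_mx (f i) (g i) (h i) (l i) =
  block_mx (\sum_i f i) (\sum_i g i) (\sum_i h i) (\sum_i l i).
Proof.
elim: (index_enum I) => [|i t IHt]; first by rewrite !big_nil block_mx0.
by rewrite !big_cons IHt add_block_mx.
Qed.

Lemma eq_antidiag_bcirc (f1 f2 g1 g2 : 'I_n -> 'M[C]_v) :
  f1 =1 g1 -> f2 =1 g2 ->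
  block_mx 0 (bcirc f1) (bcirc f2) 0 = block_mx 0 (bcirc g1) (bcirc g2) 0.
Proof. by do 2![move/eq_bcirc=> ->]. Qed.

Lemma eq_diag_bcirc (f1 f2 g1 g2 : 'I_n -> 'M[C]_v) :
  f1 =1 g1 -> f2 =1 g2 ->
  block_mx (bcirc f1) 0 0 (bcirc f2) = block_mx (bcirc g1) 0 0 (bcirc g2).
Proof. by do 2![move/eq_bcirc=> ->]. Qed.

Local Notation A0 := (@A0 R m v).
Local Notation A1 := (A1 R m v).
Local Notation A3 := (A3 R W).

(* The orientation for which [A0 i *m A2n j = A2n (i + j)]. *)
Definition A2n i := A2 R W (- i).

Definition Dmx : 'M[C]_(n * v + n * v) :=
  block_mx (Jmx R (n * v)) 0 0 (Jmx R (n * v)).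
Definition Xmx : 'M[C]_(n * v + n * v) :=
  block_mx 0 (Jmx R (n * v)) (Jmx R (n * v)) 0.

Lemma A0E i : A0 i =
  let c := bcirc (fun j => (j == i)%:R *: 1%:M) in block_mx c 0 0 c.
Proof. by rewrite /Defs.A0 bcirc_delta. Qed.

Lemma A2nE i : A2n i =
  block_mx 0 (bcirc (fun j => B (j - i))) (bcirc (fun j => (B (i - j))^T)) 0.
Proof.
apply: eq_antidiag_bcirc => j.
  by rewrite addrC.
by rewrite opprK.
Qed.

Lemma DmxE : Dmx = let c := bcirc (fun _ => J) in block_mx c 0 0 c.
Proof. by rewrite /Dmx bcirc_J. Qed.

Lemma XmxE : Xmx = let c := bcirc (fun _ => J) in block_mx 0 c c 0.
Proof. by rewrite /Xmx bcirc_J. Qed.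

Lemma sum_A0 : \sum_i A0 i = let c := bcirc (fun _ => 1%:M) in block_mx c 0 0 c.
Proof.
under eq_bigr do rewrite A0E.
rewrite sum_block_mx !sumr_const !mul0rn bcirc_sum /=.
have e : bcirc (fun j => \sum_i (j == i)%:R *: 1%:M) =
    bcirc (fun _ : 'I_n => 1%:M : 'M[C]_v).
  apply: eq_bcirc => j; under eq_bigr do rewrite eq_sym.
  exact: (sum_delta_scale _ (fun _ => 1%:M)).
by rewrite e.
Qed.

Lemma sum_A2n : \sum_i A2n i =
  block_mx 0 (bcirc (fun _ => Nmx)) (bcirc (fun _ => Nmx^T)) 0.
Proof.
under eq_bigr do rewrite A2nE.
rewrite sum_block_mx !sumr_const !mul0rn !bcirc_sum; apply: eq_antidiag_bcirc => j.
  rewrite [RHS](reindex_inj (inj_comp (addrI j) oppr_inj)).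
  exact: eq_bigr.
rewrite trNmx [RHS](reindex_inj (addIr (- j))).
exact: eq_bigr.
Qed.

Lemma A1E : A1 = Dmx - \sum_i A0 i.
Proof.
rewrite sum_A0 DmxE /= opp_block_mx add_block_mx !oppr0 !addr0 bcircB.
by rewrite /Defs.A1 bcirc_const.
Qed.

Lemma A3E : A3 = Xmx - \sum_i A2n i.
Proof.
rewrite sum_A2n XmxE /= opp_block_mx add_block_mx !oppr0 !addr0 !bcircB.
by rewrite /Defs.A3 !bcirc_const trNmx.
Qed.

Let block_mulE := (mulmx_block, mulmx0, mul0mx, addr0, add0r).

Lemma A0_mul_A0 i j : A0 i *m A0 j = A0 (i + j).
Proof.
by rewrite /Defs.A0 !block_mulE !tensmx_mul !mulmx1 CmxXM.
Qed.

Lemma deltaM i f : bcirc (fun j => (j == i)%:R *: 1%:M) *m bcirc f =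
  bcirc (fun j => f (j - i)) :> 'M[C]_(n * v).
Proof.
rewrite bcircM; apply: eq_bcirc => s.
rewrite -(sum_delta_scale i (fun j => f (s - j))); apply: eq_bigr => j _.
by rewrite -scalemxAl mul1mx.
Qed.

Lemma Mdelta i f : bcirc f *m bcirc (fun j => (j == i)%:R *: 1%:M) =
  bcirc (fun j => f (j - i)) :> 'M[C]_(n * v).
Proof.
rewrite bcircM; apply: eq_bcirc => s.
rewrite -(sum_delta_scale (s - i) f); apply: eq_bigr => j _.
rewrite -scalemxAr mulmx1; congr ((_%:R) *: _); congr nat_of_bool.
by rewrite [s - j == i]subr_eq [j == _]eq_sym subr_eq addrC.
Qed.

Lemma A0_mul_A2n i j : A0 i *m A2n j = A2n (i + j).
Proof.
rewrite A0E !A2nE !block_mulE !deltaM; apply: eq_antidiag_bcirc => l.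
  by rewrite opprD addrA.
by rewrite opprB addrCA addrA.
Qed.

Lemma A2n_mul_A0 i j : A2n j *m A0 i = A2n (i + j).
Proof.
rewrite A0E !A2nE !block_mulE !Mdelta; apply: eq_antidiag_bcirc => l.
  by rewrite opprD addrA.
by rewrite opprB addrCA addrA.
Qed.

(** The diagonal blocks of the product are convolutions whose coefficients are [row_gram] and
    [col_gram], both shifted by [i + j]. They agree because rows and columns of [W] satisfy the same
    formula. *)
Lemma A2n_mul_A2n i j : A2n i *m A2n j = kC *: A0 (i + j) + (lC / nC) *: A1.
Proof.
rewrite A0E !A2nE !block_mulE !bcircM /Defs.A1 bcirc_const !scale_block_mx.
rewrite !scaler0 add_block_mx !addr0 !bcircZ bcircD.
apply: eq_diag_bcirc => s.
  transitivity (row_gram (s - (i + j))).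
    rewrite /row_gram [RHS](reindex_inj (addIr (- i))); apply: eq_bigr => h _.
    congr (_ *m (B _)^T); rewrite !opprB addrCA.
    by rewrite !addrA subrK.
  by rewrite row_gramE scalerA subr_eq0.
transitivity (col_gram (s - (i + j))).
  rewrite /col_gram [RHS](reindex_inj (inj_comp (addrI (s - j)) oppr_inj)).
  apply: eq_bigr => h _ /=; congr ((B _)^T *m B _).
    by rewrite opprB [RHS]addrC !addrA subrK addrK.
  by rewrite addrAC.
by rewrite col_gramE scalerA subr_eq0.
Qed.

Lemma bcircJ (f : 'I_n -> 'M[C]_v) :
  bcirc f *m bcirc (fun _ => J) = bcirc (fun _ => (\sum_j f j) *m J).
Proof. by rewrite bcircM; apply: eq_bcirc => s; rewrite mulmx_suml. Qed.

Lemma Jbcirc (f : 'I_n -> 'M[C]_v) :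
  bcirc (fun _ => J) *m bcirc f = bcirc (fun _ => J *m \sum_j f j).
Proof.
rewrite bcircM; apply: eq_bcirc => s; rewrite mulmx_sumr.
by rewrite [RHS](reindex_inj (inj_comp (addrI s) oppr_inj)).
Qed.

Lemma A2n_upper_sum i : \sum_j B (j - i) = Nmx.
Proof. by rewrite /Nmx [RHS](reindex_inj (addIr (- i))). Qed.

Lemma A2n_lower_sum i : \sum_j (B (i - j))^T = Nmx^T.
Proof. by rewrite trNmx [RHS](reindex_inj (inj_comp (addrI i) oppr_inj)). Qed.

Lemma A0_mul_D i : A0 i *m Dmx = Dmx.
Proof. by rewrite A0E DmxE !block_mulE deltaM. Qed.

Lemma A0_mul_X i : A0 i *m Xmx = Xmx.
Proof. by rewrite A0E XmxE !block_mulE deltaM. Qed.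

Lemma D_mul_A0 i : Dmx *m A0 i = Dmx.
Proof. by rewrite A0E DmxE !block_mulE Mdelta. Qed.

Lemma X_mul_A0 i : Xmx *m A0 i = Xmx.
Proof. by rewrite A0E XmxE !block_mulE Mdelta. Qed.

Lemma A2n_mul_D i : A2n i *m Dmx = kC *: Xmx.
Proof.
rewrite A2nE DmxE XmxE !block_mulE !bcircJ A2n_upper_sum A2n_lower_sum NJ NTJ.
by rewrite scale_block_mx scaler0 bcircZ.
Qed.

Lemma A2n_mul_X i : A2n i *m Xmx = kC *: Dmx.
Proof.
rewrite A2nE DmxE XmxE !block_mulE !bcircJ A2n_upper_sum A2n_lower_sum NJ NTJ.
by rewrite scale_block_mx scaler0 bcircZ.
Qed.

Lemma D_mul_A2n i : Dmx *m A2n i = kC *: Xmx.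
Proof.
rewrite A2nE DmxE XmxE !block_mulE !Jbcirc A2n_upper_sum A2n_lower_sum JN JNT.
by rewrite scale_block_mx scaler0 bcircZ.
Qed.

Lemma X_mul_A2n i : Xmx *m A2n i = kC *: Dmx.
Proof.
rewrite A2nE DmxE XmxE !block_mulE !Jbcirc A2n_upper_sum A2n_lower_sum JN JNT.
by rewrite scale_block_mx scaler0 bcircZ.
Qed.

Lemma D_mul_D : Dmx *m Dmx = (nC * vC) *: Dmx.
Proof. by rewrite /Dmx !block_mulE JJ natrM scale_block_mx scaler0. Qed.

Lemma D_mul_X : Dmx *m Xmx = (nC * vC) *: Xmx.
Proof. by rewrite /Dmx /Xmx !block_mulE JJ natrM scale_block_mx scaler0. Qed.

Lemma X_mul_D : Xmx *m Dmx = (nC * vC) *: Xmx.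
Proof. by rewrite /Dmx /Xmx !block_mulE JJ natrM scale_block_mx scaler0. Qed.

Lemma X_mul_X : Xmx *m Xmx = (nC * vC) *: Dmx.
Proof. by rewrite /Dmx /Xmx !block_mulE JJ natrM scale_block_mx scaler0. Qed.

Lemma trA0 i : (A0 i)^T = A0 (- i).
Proof. by rewrite /Defs.A0 tr_block_mx !trmx0 trmx_tens trmx1 CmxXT. Qed.

Lemma trA2n i : (A2n i)^T = A2n (- i).
Proof.
rewrite !A2nE tr_block_mx !trmx0 !bcircT; apply: eq_antidiag_bcirc => j.
  by rewrite trmxK !opprK addrC.
by rewrite addrC.
Qed.

Lemma trA1 : A1^T = A1.
Proof.
by rewrite /Defs.A1 tr_block_mx !trmx0 trmx_tens linearB /= trmx1 !trJ.
Qed.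

Lemma trA3 : A3^T = A3.
Proof.
rewrite /Defs.A3 tr_block_mx !trmx0 !trmx_tens !linearB /= !trJ -trNmx.
by rewrite trmxK.
Qed.

Lemma Dmx_neq0 : Dmx != 0.
Proof.
pose z := mxtens_index (0 : 'I_n, i0).
apply/eqP => /matrixP/(_ (lshift _ z) (lshift _ z)).
by rewrite block_mxEul !mxE => /eqP; rewrite oner_eq0.
Qed.

Lemma Xmx_neq0 : Xmx != 0.
Proof.
pose z := mxtens_index (0 : 'I_n, i0).
apply/eqP => /matrixP/(_ (lshift _ z) (rshift _ z)).
by rewrite block_mxEur !mxE => /eqP; rewrite oner_eq0.
Qed.

(** Multiplication by [Dmx] turns a relation into its valency times [Dmx] or [Xmx], so a nonzero
    valency suffices. The next three lemmas use this with [n (v - 1)], [k] and [n (v - k)]. *)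
Lemma A0_neq0 i : A0 i != 0.
Proof.
by apply: contraNneq Dmx_neq0 => A0i; rewrite -(A0_mul_D i) A0i mul0mx.
Qed.

Lemma A1_neq0 : A1 != 0.
Proof.
apply/eqP => A10; have : Dmx *m A1 = (nC * (vC - 1)) *: Dmx.
  rewrite A1E mulmxBr D_mul_D mulmx_sumr; under eq_bigr do rewrite D_mul_A0.
  by rewrite sumr_const card_ord -[Dmx *+ n]scaler_nat -scalerBl mulrBr mulr1.
rewrite A10 mulmx0 => /esym/eqP; rewrite scaler_eq0 (negPf Dmx_neq0) orbF.
by rewrite mulf_eq0 pnatr_eq0 subr_eq0 pnatr_eq1 /= (gtn_eqF hv).
Qed.

Lemma A2n_neq0 i : A2n i != 0.
Proof.
apply/eqP => A2i; have := A2n_mul_D i.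
rewrite A2i mul0mx => /esym/eqP; rewrite scaler_eq0 (negPf Xmx_neq0) orbF.
by rewrite pnatr_eq0 (gtn_eqF hk).
Qed.

Lemma A3_neq0 : (k < v)%N -> A3 != 0.
Proof.
move=> ltkv; apply/eqP => A30; have : Dmx *m A3 = (nC * (vC - kC)) *: Xmx.
  rewrite A3E mulmxBr D_mul_X mulmx_sumr; under eq_bigr do rewrite D_mul_A2n.
  rewrite sumr_const card_ord -[(kC *: Xmx) *+ n]scaler_nat scalerA -scalerBl.
  by rewrite mulrBr.
rewrite A30 mulmx0 => /esym/eqP; rewrite scaler_eq0 (negPf Xmx_neq0) orbF.
by rewrite mulf_eq0 pnatr_eq0 subr_eq0 eqr_nat /= (gtn_eqF ltkv).
Qed.

Lemma A3_eq0 : k = v -> A3 = 0.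
Proof.
move=> kv; rewrite /Defs.A3 -trNmx -/Nmx Nmx_full // trJ subrr tensmx0.
exact: block_mx0.
Qed.

Lemma block_01 p q (a b c d : 'M[C]_(p, q)) :
  (forall x y, a x y = 0 \/ a x y = 1) -> (forall x y, b x y = 0 \/ b x y = 1) ->
  (forall x y, c x y = 0 \/ c x y = 1) -> (forall x y, d x y = 0 \/ d x y = 1) ->
  forall x y, block_mx a b c d x y = 0 \/ block_mx a b c d x y = 1.
Proof.
move=> ha hb hc hd x y.
by case: (split_ordP x) => x' ->; case: (split_ordP y) => y' ->;
  rewrite ?block_mxEul ?block_mxEur ?block_mxEdl ?block_mxEdr.
Qed.

Lemma bcirc_01 (f : 'I_n -> 'M[C]_v) :
  (forall j x y, f j x y = 0 \/ f j x y = 1) ->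
  forall x y, bcirc f x y = 0 \/ bcirc f x y = 1.
Proof.
move=> hf x y; case: (mxtens_indexP x) => a x'; case: (mxtens_indexP y) => b y'.
by rewrite bcircE.
Qed.

Lemma zero_01 p q (x : 'I_p) (y : 'I_q) :
  (0 : 'M[C]_(p, q)) x y = 0 \/ (0 : 'M[C]_(p, q)) x y = 1.
Proof. by left; rewrite mxE. Qed.

Lemma A0_01 i x y : A0 i x y = 0 \/ A0 i x y = 1.
Proof.
rewrite A0E /=; apply: block_01 => //; try exact: zero_01; apply: bcirc_01 => j a b;
  rewrite !mxE; case: eqP => _; case: eqP => _; rewrite ?mulr0 ?mulr1; by [left | right].
Qed.

Lemma A1_01 x y : A1 x y = 0 \/ A1 x y = 1.
Proof.
rewrite /Defs.A1 !bcirc_const; apply: block_01 => //; try exact: zero_01;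
  apply: bcirc_01 => j a b; rewrite !mxE;
  case: eqP => _; rewrite ?subrr ?subr0; by [left | right].
Qed.

Lemma A2n_01 i x y : A2n i x y = 0 \/ A2n i x y = 1.
Proof.
rewrite A2nE; apply: block_01 => //; try exact: zero_01;
  apply: bcirc_01 => j a b; rewrite !mxE; case: eqP => _; by [left | right].
Qed.

Lemma A3_01 x y : A3 x y = 0 \/ A3 x y = 1.
Proof.
have e a b : (J - Nmx) a b = 0 \/ (J - Nmx) a b = 1.
  rewrite mxE [J a b]mxE mxE NmxE.
  by case: eqP => _; rewrite ?subrr ?subr0; [right | left].
have eT : J - Nmx^T = (J - Nmx)^T by rewrite linearB /= trJ.
rewrite /Defs.A3 -trNmx -/Nmx eT !bcirc_const.
apply: block_01 => //; try exact: zero_01; apply: bcirc_01 => j a b //.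
by rewrite mxE.
Qed.

Lemma A0_0 : A0 0 = 1%:M.
Proof. by rewrite /Defs.A0 expr0 tensmx1 -scalar_mx_block. Qed.

Lemma DX_const : Dmx + Xmx = const_mx 1.
Proof. by rewrite add_block_mx !addr0 !add0r block_mx_const. Qed.

End BGW.

(** * Eigenvalues *)

Section Fourier.
Variables (R : realType) (m N : nat).
Local Notation n := (m.+1).
Local Notation C := R[i].
Local Notation nC := (n%:R : C).
Local Notation w := (omega R m).
Implicit Types a b : 'I_n -> 'M[C]_N.

Lemma sum_linD a b (x y : C) :
  \sum_j (x *: a j + y *: b j) = x *: \sum_j a j + y *: \sum_j b j.
Proof. by rewrite big_split /= -!scaler_sumr. Qed.

Lemma sum_linB a b (x y : C) :
  \sum_j (x *: a j - y *: b j) = x *: \sum_j a j - y *: \sum_j b j.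
Proof. by rewrite sumrB -!scaler_sumr. Qed.

Lemma sum_mxD a b : \sum_j (a j + b j) = \sum_j a j + \sum_j b j.
Proof. exact: big_split. Qed.

Lemma sum_mxB a b : \sum_j (a j - b j) = \sum_j a j - \sum_j b j.
Proof. exact: sumrB. Qed.

Lemma sum_mxZ a (x : C) : \sum_j x *: a j = x *: \sum_j a j.
Proof. by rewrite scaler_sumr. Qed.

Definition fourier a (j : 'I_n) := \sum_(l < n) w ^+ (j * l) *: a l.

Lemma fourier0 a : fourier a 0 = \sum_l a l.
Proof. by apply: eq_bigr => l _; rewrite mul0n expr0 scale1r. Qed.

(** Translating the family multiplies its transform by a character value; this is the source of the
    eigenvalues on E3 and E4. *)
Lemma fourier_shift a (i j : 'I_n) :
  \sum_(l < n) w ^+ (j * l) *: a (i + l) = w ^- (i * j) *: fourier a j.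
Proof.
rewrite [LHS](reindex_inj (addIr (- i))) scaler_sumr; apply: eq_bigr => l _.
rewrite omegaXM_sub [i + (l - i)]addrC subrK scalerA mulrC.
by rewrite (mulnC i).
Qed.

Lemma fourier_const (M : 'M[C]_N) (j : 'I_n) :
  j != 0 -> \sum_(l < n) w ^+ (j * l) *: M = 0.
Proof. by move=> j0; rewrite -scaler_suml sum_omega_row // scale0r. Qed.

Lemma fourier_inv a (i : 'I_n) : \sum_(j < n) w ^- (i * j) *: fourier a j = nC *: a i.
Proof.
under eq_bigr do rewrite scaler_sumr.
rewrite exchange_big /= (bigD1 i) //= [X in _ + X]big1 ?addr0 => [|l li].
  under eq_bigr do rewrite scalerA.
  by rewrite -scaler_suml sum_omega_delta eqxx mulr1.
under eq_bigr do rewrite scalerA.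
by rewrite -scaler_suml sum_omega_delta eq_sym (negPf li) mulr0 scale0r.
Qed.

Lemma sum_nonzero_idx (V : zmodType) (f : 'I_n -> V) :
  \sum_(j : nonzero_idx m) f (val j) = \sum_j f j - f 0.
Proof.
rewrite [in RHS](bigD1 0) //= addrC addrK.
by rewrite -(big_sub (fun j : 'I_n => j != 0)).
Qed.

(** E3 and E4 are labelled by the nontrivial characters only. The trivial one would contribute the
    plain sum, which is therefore subtracted. *)
Lemma fourier_inv_nonzero a (i : 'I_n) :
  \sum_(j : nonzero_idx m) w ^- (i * val j) *: fourier a (val j) =
  nC *: a i - \sum_l a l.
Proof.
rewrite (sum_nonzero_idx (fun j => w ^- (i * j) *: fourier a j)) fourier_inv.
by rewrite muln0 expr0 invr1 scale1r fourier0.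
Qed.

End Fourier.

(** * Expansions and eigenvalues of the idempotents, for abstract families of matrices *)

Section Spectrum.
Variables (R : realType) (m N : nat).
Local Notation n := (m.+1).
Local Notation C := R[i].
Local Notation nC := (n%:R : C).
Local Notation w := (omega R m).
Variables (a0 a2 : 'I_n -> 'M[C]_N) (D X : 'M[C]_N) (c0 v k l : C).
Local Notation T := (\sum_i a0 i).
Local Notation S := (\sum_i a2 i).

(* The idempotents, up to the choice of the coefficient [e]: [eJ (+-1)] are
   E0, E1; [eD] gives E21, E22; [eF] gives E3, E4. *)
Definition eJ e := c0 *: (D + e *: X).
Definition eD e := c0 *: (v *: T - D + e *: (v *: S - k *: X)).
Definition eF e j := c0 *: (v *: fourier a0 j + e *: fourier a2 j).

Lemma sum_eF (i : 'I_n) e :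
  \sum_(j : nonzero_idx m) w ^- (i * val j) *: eF e (val j) =
  c0 *: (v *: (nC *: a0 i - T) + e *: (nC *: a2 i - S)).
Proof.
rewrite -!fourier_inv_nonzero !scaler_sumr -big_split scaler_sumr.
by apply: eq_bigr => j _; apply/matrixP => x y; rewrite !mxE; ring.
Qed.

Lemma eF_sumE e (j : 'I_n) :
  eF e j = c0 *: \sum_(i < n) w ^+ (j * i) *: (v *: a0 i + e *: a2 i).
Proof.
rewrite /eF /fourier !scaler_sumr -big_split scaler_sumr /=.
by apply: eq_bigr => i _; apply/matrixP => x y; rewrite !mxE; ring.
Qed.

Lemma eF_sumBE e (j : 'I_n) :
  eF (- e) j = c0 *: \sum_(i < n) w ^+ (j * i) *: (v *: a0 i - e *: a2 i).
Proof. by rewrite eF_sumE; under eq_bigr do rewrite scaleNr. Qed.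

Lemma eF_expand e (j : 'I_n) : eF e j = c0 *: (
  \sum_(i < n) (v * w ^+ (i * j)) *: a0 i + \sum_(i < n) (e * w ^+ (i * j)) *: a2 i).
Proof.
rewrite /eF /fourier !scaler_sumr; congr (_ *: (_ + _)).
  by apply: eq_bigr => i _; rewrite scalerA mulnC.
by apply: eq_bigr => i _; rewrite scalerA mulnC.
Qed.

Lemma sum_eFZ (i : 'I_n) e z :
  \sum_(j : nonzero_idx m) (z * w ^- (i * val j)) *: eF e (val j) =
  z *: (c0 *: (v *: (nC *: a0 i - T) + e *: (nC *: a2 i - S))).
Proof.
by rewrite -sum_eF scaler_sumr; apply: eq_bigr => j _; rewrite scalerA.
Qed.

Section Expansion.
Variables (A1 A3 : 'M[C]_N) (sv svk sk : C).
Hypothesis A1E : A1 = D - T.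
Hypothesis A3E : A3 = X - S.
Hypothesis n0 : nC != 0.
Hypothesis v0 : v != 0.
Hypothesis c0E : c0 = (2 * nC * v)^-1.
Hypothesis sk0 : sk != 0.
Hypothesis sk2 : sk * sk = k.
Hypothesis sv0 : sv != 0.

(** The form in which [field] asks for [n] to be nonzero. *)
Let n1 : 1 + m%:R != 0 :> C. Proof. by rewrite addrC natr1. Qed.

Lemma eJ1E : eJ 1 = c0 *: (\sum_j (a0 j + a2 j) + A1 + A3).
Proof.
rewrite sum_mxD A1E A3E; congr (_ *: _).
move: T S => p q; apply/matrixP => x y; rewrite !mxE.
ring.
Qed.

Lemma eJN1E : eJ (-1) = c0 *: (\sum_j (a0 j - a2 j) + A1 - A3).
Proof.
rewrite sum_mxB A1E A3E; congr (_ *: _).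
move: T S => p q; apply/matrixP => x y; rewrite !mxE.
ring.
Qed.

Lemma eJ_expand e :
  eJ e = c0 *: (\sum_i 1 *: a0 i + \sum_i e *: a2 i + 1 *: A1 + e *: A3).
Proof.
rewrite !sum_mxZ A1E A3E; congr (_ *: _).
move: T S => p q; apply/matrixP => x y; rewrite !mxE.
ring.
Qed.

Lemma scale_twice (z : C) (M : 'M[C]_N) : z *: (M + M) = (2 * z) *: M.
Proof. by rewrite scalerDr -scalerDl -mulr2n mulr_natl. Qed.

Lemma comb_add (x y : C) (M1 M2 M3 M4 : 'M[C]_N) :
  x *: M1 + x *: M2 + (y *: M3 + y *: M4) = x *: (M1 + M2) + y *: (M3 + M4).
Proof. by rewrite !scalerDr. Qed.

Lemma comb_sub (x y : C) (M1 M2 M3 M4 : 'M[C]_N) :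
  x *: M1 + - x *: M2 + (y *: M3 + - y *: M4) = x *: (M1 - M2) + y *: (M3 - M4).
Proof. by rewrite !scalerBr !scaleNr. Qed.

Lemma eJ_add : eJ 1 + eJ (-1) = (2 * c0) *: D.
Proof.
by rewrite /eJ -scalerDr scale1r scaleN1r addrACA subrr addr0 scale_twice.
Qed.

Lemma eJ_sub : eJ 1 - eJ (-1) = (2 * c0) *: X.
Proof.
rewrite /eJ -scalerBr scale1r scaleN1r opprB addrC addrA subrK.
exact: scale_twice.
Qed.

Lemma eD_add e : eD e + eD (- e) = (2 * c0) *: (v *: T - D).
Proof.
rewrite /eD -scalerDr scaleNr; set Y := _ *: T - D; set Z := e *: _.
by rewrite addrACA subrr addr0 scale_twice.
Qed.

Lemma eD_sub e : eD e - eD (- e) = (2 * c0 * e) *: (v *: S - k *: X).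
Proof.
rewrite /eD -scalerBr scaleNr -[RHS]scalerA.
set Y := _ *: T - D; set Z := e *: _.
rewrite opprB addrC addrA subrK.
exact: scale_twice.
Qed.

(** The [a2] parts have opposite signs and cancel. The [a0] parts add up to Fourier inversion
    without the trivial character, where [2 c0 v n = 1]. In [sum_eF_double] the roles of [a0] and
    [a2] are exchanged. *)
Lemma sum_eF_cancel (i : 'I_n) e :
  \sum_(j : nonzero_idx m) w ^- (i * val j) *: eF e (val j) +
  \sum_(j : nonzero_idx m) w ^- (i * val j) *: eF (- e) (val j) =
  a0 i - (2 * c0 * v) *: T.
Proof.
rewrite !sum_eF c0E; move: T S => p q; apply/matrixP => x y; rewrite !mxE.
by field; rewrite v0 n1.
Qed.

Lemma sum_eF_double (i : 'I_n) :
  \sum_(j : nonzero_idx m) (sk * w ^- (i * val j)) *: eF (v / sk) (val j) +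
  \sum_(j : nonzero_idx m) (- sk * w ^- (i * val j)) *: eF (- (v / sk)) (val j) =
  a2 i - (2 * c0 * v) *: S.
Proof.
rewrite !sum_eFZ c0E; move: T S => p q; apply/matrixP => x y; rewrite !mxE.
by field; rewrite sk0 v0 n1.
Qed.

Lemma sum_scale0 (e : C) : \sum_(j : nonzero_idx m) 0 *: eF e (val j) = 0.
Proof. by rewrite big1 // => j _; rewrite scale0r. Qed.

Section Strict.
Hypothesis svk0 : svk != 0.
Hypothesis svk2 : svk * svk = v - k.
Local Notation r := (sv / (svk * sk)).
Variables rho s2 s3 : C.
Hypothesis rhoE : rho = sk * svk / sv.
Hypothesis s2E : s2 = sv * svk / sk.
Hypothesis s3E : s3 = sv * sk / svk.

(** Replacing [v] and [k] by sums of squares of the roots leaves rational identities for [field]. *)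
Let vE : v = svk * svk + sk * sk. Proof. by rewrite svk2 sk2 subrK. Qed.

(** After substituting [X = A3 + S], the matrix [eD e] has coefficient [e (v - k)] on the [a2 i] and
    [- e k] on [A3]. The choice [e = r] makes these [s2] and [- s3]. *)
Lemma eD_expand : eD r = c0 *: (
  \sum_i (v - 1) *: a0 i + \sum_i s2 *: a2 i +
  (-1) *: A1 + - s3 *: A3).
Proof.
rewrite !sum_mxZ A1E A3E s2E s3E /eD; congr (_ *: _).
move: T S => p q; apply/matrixP => x y; rewrite !mxE.
by rewrite vE -sk2; field; rewrite svk0 sk0.
Qed.

Lemma eDN_expand : eD (- r) = c0 *: (
  \sum_i (v - 1) *: a0 i + \sum_i - s2 *: a2 i +
  (-1) *: A1 + s3 *: A3).
Proof.
rewrite !sum_mxZ A1E A3E s2E s3E /eD; congr (_ *: _).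
move: T S => p q; apply/matrixP => x y; rewrite !mxE.
by rewrite vE -sk2; field; rewrite svk0 sk0.
Qed.

Lemma eD_E : eD r = c0 *: (
  \sum_j ((v - 1) *: a0 j + s2 *: a2 j) - A1 - s3 *: A3).
Proof.
rewrite eD_expand !sum_mxZ sum_linD; congr (_ *: _).
move: T S => p q; apply/matrixP => x y.
rewrite !mxE; ring.
Qed.

Lemma eDN_E : eD (- r) = c0 *: (
  \sum_j ((v - 1) *: a0 j - s2 *: a2 j) - A1 + s3 *: A3).
Proof.
rewrite eDN_expand !sum_mxZ sum_linB; congr (_ *: _).
move: T S => p q; apply/matrixP => x y.
rewrite !mxE; ring.
Qed.

(** The nontrivial characters miss [2 c0 v T]. The sum of [eJ 1] and [eJ (-1)] supplies [2 c0 D],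
    and that of [eD r] and [eD (- r)] supplies [2 c0 (v T - D)]. *)
Lemma a0_expansion_lt (i : 'I_n) e :
  \sum_(j : nonzero_idx m) w ^- (i * val j) *: eF e (val j) +
  \sum_(j : nonzero_idx m) w ^- (i * val j) *: eF (- e) (val j) +
  (1 *: eJ 1 + 1 *: eJ (-1) + (1 *: eD r + 1 *: eD (- r))) = a0 i.
Proof.
rewrite sum_eF_cancel comb_add eJ_add eD_add.
move: T S => p q; apply/matrixP => x y; rewrite !mxE.
ring.
Qed.

Lemma a1_expansion_lt e : \sum_(j : nonzero_idx m) 0 *: eF e (val j) +
  \sum_(j : nonzero_idx m) 0 *: eF (- e) (val j) +
  ((nC * (v - 1)) *: eJ 1 + (nC * (v - 1)) *: eJ (-1) +
    (- nC *: eD r + - nC *: eD (- r))) = A1.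
Proof.
rewrite !sum_scale0 comb_add eJ_add eD_add A1E c0E.
move: T S => p q; apply/matrixP => x y; rewrite !mxE.
by field; rewrite v0 n1.
Qed.

(** Differences of idempotents now enter. As [rho * r = 1], the multiples of [X] cancel and the
    missing [2 c0 v S] remains. *)
Lemma a2_expansion_lt (i : 'I_n) :
  \sum_(j : nonzero_idx m) (sk * w ^- (i * val j)) *: eF (v / sk) (val j) +
  \sum_(j : nonzero_idx m) (- sk * w ^- (i * val j)) *: eF (- (v / sk)) (val j) +
  (k *: eJ 1 + - k *: eJ (-1) + (rho *: eD r + - rho *: eD (- r))) = a2 i.
Proof.
rewrite sum_eF_double comb_sub eJ_sub eD_sub rhoE.
move: T S => p q; apply/matrixP => x y; rewrite !mxE.
by field; rewrite sk0 svk0 sv0.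
Qed.

Lemma a3_expansion_lt e : \sum_(j : nonzero_idx m) 0 *: eF e (val j) +
  \sum_(j : nonzero_idx m) 0 *: eF (- e) (val j) +
  ((nC * (v - k)) *: eJ 1 + (- nC * (v - k)) *: eJ (-1) +
    ((- nC * rho) *: eD r + (nC * rho) *: eD (- r))) = A3.
Proof.
rewrite !sum_scale0 [- nC * (v - k)]mulNr -[nC * rho]opprK -[- (nC * rho)]mulNr.
rewrite comb_sub eJ_sub eD_sub A3E c0E rhoE.
move: T S => p q; apply/matrixP => x y; rewrite !mxE.
by field; rewrite sk0 svk0 sv0 v0 n1.
Qed.

End Strict.

Section Full.
Hypothesis A30 : A3 = 0.
Hypothesis kv : k = v.

Let SX : S = X. Proof. by apply/esym/eqP; rewrite -subr_eq0 -A3E A30. Qed.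

Lemma eD0_double : 2 *: eD 0 = (2 * c0) *: (v *: T - D).
Proof. by rewrite -(eD_add 0) oppr0 scaler_nat mulr2n. Qed.

(** The [s] terms cancel and [A3] is 0, so [s] and [t] may be arbitrary. In particular the
    coefficient of [A3] with denominator [sqC (v - k) = 0] does no harm. *)
Lemma eD0_E s t :
  c0 *: (\sum_j ((v - 1) *: a0 j + s *: a2 j) - A1 - t *: A3) +
  c0 *: (\sum_j ((v - 1) *: a0 j - s *: a2 j) - A1 + t *: A3) = 2 *: eD 0.
Proof.
rewrite sum_linD sum_linB A1E A30 eD0_double -scalerDr.
move: T S => p q; apply/matrixP => x y; rewrite !mxE.
ring.
Qed.

Lemma eJ_expand_eq e :
  eJ e = c0 *: (\sum_i 1 *: a0 i + \sum_i e *: a2 i + 1 *: A1).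
Proof. by rewrite eJ_expand A30 scaler0 addr0. Qed.

Lemma eD0_expand : 2 *: eD 0 = c0 *: (
  \sum_i (2 * (v - 1)) *: a0 i + \sum_i 0 *: a2 i + (-2) *: A1).
Proof.
rewrite !sum_mxZ A1E eD0_double -scale_twice.
congr (_ *: _).
move: T S => p q; apply/matrixP => x y; rewrite !mxE.
ring.
Qed.

Lemma a0_expansion_eq (i : 'I_n) e :
  \sum_(j : nonzero_idx m) w ^- (i * val j) *: eF e (val j) +
  \sum_(j : nonzero_idx m) w ^- (i * val j) *: eF (- e) (val j) +
  (1 *: eJ 1 + 1 *: eJ (-1) + 1 *: (2 *: eD 0)) = a0 i.
Proof.
rewrite sum_eF_cancel -(scalerDr 1) eJ_add eD0_double.
move: T S => p q; apply/matrixP => x y; rewrite !mxE.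
ring.
Qed.

Lemma a1_expansion_eq e : \sum_(j : nonzero_idx m) 0 *: eF e (val j) +
  \sum_(j : nonzero_idx m) 0 *: eF (- e) (val j) +
  ((nC * (v - 1)) *: eJ 1 + (nC * (v - 1)) *: eJ (-1) +
    - nC *: (2 *: eD 0)) = A1.
Proof.
rewrite !sum_scale0 -(scalerDr (nC * (v - 1))) eJ_add eD0_double A1E c0E.
move: T S => p q; apply/matrixP => x y; rewrite !mxE.
by field; rewrite v0 n1.
Qed.

Lemma a2_expansion_eq (i : 'I_n) :
  \sum_(j : nonzero_idx m) (sk * w ^- (i * val j)) *: eF (v / sk) (val j) +
  \sum_(j : nonzero_idx m) (- sk * w ^- (i * val j)) *: eF (- (v / sk)) (val j) +
  (k *: eJ 1 + - k *: eJ (-1) + 0 *: (2 *: eD 0)) = a2 i.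
Proof.
rewrite sum_eF_double (scaleNr k) -(scalerBr k) eJ_sub (scale0r (2 *: _)) addr0 SX kv.
move: T S => p q; apply/matrixP => x y; rewrite !mxE.
ring.
Qed.

End Full.

End Expansion.

(** The multiplication table of the Bose-Mesner algebra in terms of [a0], [a2], [D] and [X],
    together with the parameter identity obtained by counting. The eigenvalues below are derived
    from it alone. *)
Record bm_relations : Prop := BMRelations {
  rel_a0a0 : forall i j, a0 i *m a0 j = a0 (i + j);
  rel_a0a2 : forall i j, a0 i *m a2 j = a2 (i + j);
  rel_a2a0 : forall i j, a2 j *m a0 i = a2 (i + j);
  rel_a2a2 : forall i j, a2 i *m a2 j = k *: a0 (i + j) + (l / nC) *: (D - T);
  rel_a0D : forall i, a0 i *m D = D;
  rel_a0X : forall i, a0 i *m X = X;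
  rel_a2D : forall i, a2 i *m D = k *: X;
  rel_a2X : forall i, a2 i *m X = k *: D;
  rel_Da0 : forall i, D *m a0 i = D;
  rel_Xa0 : forall i, X *m a0 i = X;
  rel_Da2 : forall i, D *m a2 i = k *: X;
  rel_Xa2 : forall i, X *m a2 i = k *: D;
  rel_DD : D *m D = (nC * v) *: D;
  rel_DX : D *m X = (nC * v) *: X;
  rel_XD : X *m D = (nC * v) *: X;
  rel_XX : X *m X = (nC * v) *: D;
  rel_kk : k * k = k - l + l * v
}.

Hypothesis rels : bm_relations.

Let a0a0 := rel_a0a0 rels.
Let a0a2 := rel_a0a2 rels.
Let a2a0 := rel_a2a0 rels.
Let a2a2 := rel_a2a2 rels.
Let a0D := rel_a0D rels.
Let a0X := rel_a0X rels.
Let a2D := rel_a2D rels.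
Let a2X := rel_a2X rels.
Let Da0 := rel_Da0 rels.
Let Xa0 := rel_Xa0 rels.
Let Da2 := rel_Da2 rels.
Let Xa2 := rel_Xa2 rels.
Let DD := rel_DD rels.
Let DX := rel_DX rels.
Let XD := rel_XD rels.
Let XX := rel_XX rels.
Let kk := rel_kk rels.

Let sum_const (M : 'M[C]_N) : \sum_(i < n) M = nC *: M.
Proof. by rewrite sumr_const card_ord scaler_nat. Qed.

Let n0 : nC != 0. Proof. by rewrite pnatr_eq0. Qed.

Let a0T i : a0 i *m T = T.
Proof.
rewrite mulmx_sumr [RHS](reindex_inj (addrI i)).
by apply: eq_bigr => j _; rewrite a0a0.
Qed.

Let a0S i : a0 i *m S = S.
Proof.
rewrite mulmx_sumr [RHS](reindex_inj (addrI i)).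
by apply: eq_bigr => j _; rewrite a0a2.
Qed.

Let a2T i : a2 i *m T = S.
Proof.
rewrite mulmx_sumr [RHS](reindex_inj (addIr i)).
by apply: eq_bigr => j _; rewrite a2a0.
Qed.

Let a2S i : a2 i *m S = k *: T + l *: (D - T).
Proof.
rewrite mulmx_sumr; under eq_bigr do rewrite a2a2.
rewrite big_split /= sum_const scalerA [nC * _]mulrC divfK // -scaler_sumr.
by congr (_ *: _ + _); rewrite [RHS](reindex_inj (addrI i)).
Qed.

Let DT : D *m T = nC *: D.
Proof. by rewrite mulmx_sumr; under eq_bigr do rewrite Da0; rewrite sum_const. Qed.

Let XT : X *m T = nC *: X.
Proof. by rewrite mulmx_sumr; under eq_bigr do rewrite Xa0; rewrite sum_const. Qed.

Let DS : D *m S = (nC * k) *: X.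
Proof.
by rewrite mulmx_sumr; under eq_bigr do rewrite Da2; rewrite sum_const scalerA.
Qed.

Let XS : X *m S = (nC * k) *: D.
Proof.
by rewrite mulmx_sumr; under eq_bigr do rewrite Xa2; rewrite sum_const scalerA.
Qed.

Let mulfourier (M : 'M[C]_N) a b (j : 'I_n) : (forall i, M *m a i = b i) ->
  M *m fourier a j = \sum_(i < n) w ^+ (j * i) *: b i.
Proof.
move=> Mab; rewrite mulmx_sumr; apply: eq_bigr => i _.
by rewrite -scalemxAr Mab.
Qed.

Let mulE := (mulmxDr, mulmxN).

Lemma a0_eJ i e : a0 i *m eJ e = eJ e.
Proof. by rewrite /eJ -scalemxAr mulE -scalemxAr a0D a0X. Qed.

Lemma a0_eD i e : a0 i *m eD e = eD e.
Proof. by rewrite /eD -scalemxAr !mulE -!scalemxAr !mulE -!scalemxAr a0D a0X a0T a0S. Qed.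

Lemma a0_eF (i : 'I_n) e (j : 'I_n) : a0 i *m eF e j = w ^- (i * j) *: eF e j.
Proof.
rewrite /eF -scalemxAr mulE -!scalemxAr (mulfourier _ (a0a0 i)) (mulfourier _ (a0a2 i)).
by rewrite !fourier_shift; apply/matrixP => x y; rewrite !mxE; ring.
Qed.

(** Up to the factor [k], [a2 i] exchanges [D] and [X]. *)
Lemma a2_eJ i e : e * e = 1 -> a2 i *m eJ e = (k * e) *: eJ e.
Proof.
move=> ee; rewrite /eJ -scalemxAr mulE -scalemxAr a2D a2X.
apply/matrixP => x y; rewrite !mxE -[X x y in LHS]mul1r -ee; ring.
Qed.

(** By the parameter identity, [a2 i] sends [v T - D] to [v S - k X], and the latter to
    [(k - l) (v T - D)]. The two hypotheses are the eigenvector equations in this plane. *)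
Lemma a2_eD i e t : t * e = 1 -> e * (k - l) = t ->
  a2 i *m eD e = t *: eD e.
Proof.
move=> te ek.
rewrite /eD -scalemxAr !mulE -!scalemxAr !mulE -!scalemxAr a2D a2X a2T a2S.
apply/matrixP => x y; rewrite !mxE; move: (T x y) (S x y) (D x y) (X x y) => p q r s.
rewrite -[RHS]mulrCA; congr (c0 * _).
rewrite [in RHS]mulrDr [t * (e * _)]mulrA te mul1r -ek addrC; congr (_ + _).
have -> : k * (k * r) = (k - l + l * v) * r by rewrite mulrA kk.
ring.
Qed.

Lemma a2_eD0 i : v *: S = k *: X -> a2 i *m eD 0 = 0.
Proof.
move=> SX; rewrite /eD scale0r addr0 -scalemxAr !mulE -!scalemxAr a2D a2T SX.
by rewrite subrr scaler0.
Qed.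

(** Up to the character value, [a2 i] sends [fourier a0 j] to [fourier a2 j], and that to [k] times
    [fourier a0 j]. The term with [D - T] is constant in the summation index, so the nontrivial
    character kills it. *)
Lemma a2_eF (i : 'I_n) e t (j : 'I_n) : j != 0 -> t * v = e * k -> t * e = v ->
  a2 i *m eF e j = (t * w ^- (i * j)) *: eF e j.
Proof.
move=> j0 tv te.
have a2F : a2 i *m fourier a0 j = w ^- (i * j) *: fourier a2 j.
  rewrite (mulfourier (b := fun h => a2 (i + h))) ?fourier_shift // => h.
  by rewrite a2a0 addrC.
have a2G : a2 i *m fourier a2 j = (k * w ^- (i * j)) *: fourier a0 j.
  rewrite (mulfourier _ (a2a2 i)); under eq_bigr do rewrite scalerDr.
  rewrite big_split /= fourier_const // addr0 -scalerA -fourier_shift.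
  by rewrite scaler_sumr; apply: eq_bigr => h _; rewrite !scalerA mulrC.
rewrite /eF -scalemxAr mulE -!scalemxAr a2F a2G.
apply/matrixP => x y; rewrite !mxE; move: (fourier a0 j x y) (fourier a2 j x y) => p q.
move: (w ^- _) => z.
have -> : v * (z * q) + e * (k * z * p) = v * z * q + e * k * z * p by ring.
by rewrite -tv -te; ring.
Qed.

Lemma D_eJ e : D *m eJ e = (nC * v) *: eJ e.
Proof.
rewrite /eJ -scalemxAr mulE -scalemxAr DD DX.
by apply/matrixP => x y; rewrite !mxE; ring.
Qed.

Lemma X_eJ e : e * e = 1 -> X *m eJ e = (nC * v * e) *: eJ e.
Proof.
move=> ee; rewrite /eJ -scalemxAr mulE -scalemxAr XD XX.
apply/matrixP => x y; rewrite !mxE.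
by rewrite -[X x y in LHS]mul1r -ee; ring.
Qed.

Lemma D_eD e : D *m eD e = 0.
Proof.
rewrite /eD -scalemxAr !mulE -!scalemxAr !mulE -!scalemxAr DD DX DT DS.
by apply/matrixP => x y; rewrite !mxE; ring.
Qed.

Lemma X_eD e : X *m eD e = 0.
Proof.
rewrite /eD -scalemxAr !mulE -!scalemxAr !mulE -!scalemxAr XD XX XT XS.
by apply/matrixP => x y; rewrite !mxE; ring.
Qed.

Lemma D_eF e (j : 'I_n) : j != 0 -> D *m eF e j = 0.
Proof.
move=> j0; rewrite /eF -scalemxAr mulE -!scalemxAr (mulfourier _ Da0) (mulfourier _ Da2).
by rewrite !fourier_const // !scaler0 addr0 scaler0.
Qed.

Lemma X_eF e (j : 'I_n) : j != 0 -> X *m eF e j = 0.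
Proof.
move=> j0; rewrite /eF -scalemxAr mulE -!scalemxAr (mulfourier _ Xa0) (mulfourier _ Xa2).
by rewrite !fourier_const // !scaler0 addr0 scaler0.
Qed.

Lemma a1_eigen e (M : 'M[C]_N) (p : 'I_n -> C) :
  D *m M = e *: M -> (forall i, a0 i *m M = p i *: M) ->
  (D - T) *m M = (e - \sum_i p i) *: M.
Proof.
move=> DM a0M; rewrite mulmxBl DM mulmx_suml scalerBl scaler_suml.
by under eq_bigr do rewrite a0M.
Qed.

Lemma a3_eigen e (M : 'M[C]_N) (p : 'I_n -> C) :
  X *m M = e *: M -> (forall i, a2 i *m M = p i *: M) ->
  (X - S) *m M = (e - \sum_i p i) *: M.
Proof.
move=> XM a2M; rewrite mulmxBl XM mulmx_suml scalerBl scaler_suml.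
by under eq_bigr do rewrite a2M.
Qed.

Lemma sum_omegaV (j : 'I_n) : j != 0 -> \sum_(i < n) w ^- (i * j) = 0.
Proof.
move=> j0; have := sum_omega_delta R j 0.
rewrite (negPf j0) mulr0; apply: etrans; apply: eq_bigr => i _.
by rewrite muln0 expr0 mulr1 mulnC.
Qed.

Let sumC (x : C) : \sum_(i < n) x = nC * x.
Proof. by rewrite sumr_const card_ord mulr_natl. Qed.

Lemma a0_eJ_eigen i e : a0 i *m eJ e = 1 *: eJ e.
Proof. by rewrite a0_eJ scale1r. Qed.

Lemma a0_eD_eigen i e : a0 i *m eD e = 1 *: eD e.
Proof. by rewrite a0_eD scale1r. Qed.

Lemma a1_eJ_eigen e : (D - T) *m eJ e = (nC * (v - 1)) *: eJ e.
Proof.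
rewrite (a1_eigen (D_eJ e) (fun i => a0_eJ_eigen i e)) sumC.
by rewrite -mulrBr.
Qed.

Lemma a1_eD_eigen e : (D - T) *m eD e = - nC *: eD e.
Proof.
have De : D *m eD e = 0 *: eD e by rewrite D_eD scale0r.
by rewrite (a1_eigen De (fun i => a0_eD_eigen i e)) sumC mulr1 sub0r.
Qed.

Lemma a1_eF_eigen e (j : 'I_n) : j != 0 -> (D - T) *m eF e j = 0 *: eF e j.
Proof.
move=> j0; have De : D *m eF e j = 0 *: eF e j by rewrite D_eF // scale0r.
by rewrite (a1_eigen De (fun i => a0_eF i e j)) sum_omegaV // subr0.
Qed.

Lemma a2_eJ1_eigen i : a2 i *m eJ 1 = k *: eJ 1.
Proof. by rewrite a2_eJ ?mulr1. Qed.

Lemma a2_eJN1_eigen i : a2 i *m eJ (-1) = - k *: eJ (-1).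
Proof. by rewrite a2_eJ ?mulrN1 ?opprK. Qed.

Lemma a3_eJ1_eigen : (X - S) *m eJ 1 = (nC * (v - k)) *: eJ 1.
Proof.
have Xe : X *m eJ 1 = (nC * v) *: eJ 1 by rewrite X_eJ ?mulr1.
by rewrite (a3_eigen Xe a2_eJ1_eigen) sumC -mulrBr.
Qed.

Lemma a3_eJN1_eigen : (X - S) *m eJ (-1) = (- nC * (v - k)) *: eJ (-1).
Proof.
have Xe : X *m eJ (-1) = - (nC * v) *: eJ (-1).
  by rewrite X_eJ ?mulrN1 ?opprK.
rewrite (a3_eigen Xe a2_eJN1_eigen) sumC; congr (_ *: _); ring.
Qed.

Section Roots.
Variable sk : C.
Hypothesis sk0 : sk != 0.
Hypothesis sk2 : sk * sk = k.

Lemma a2_eF_eigen (i j : 'I_n) : j != 0 ->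
  a2 i *m eF (v / sk) j = (sk * w ^- (i * j)) *: eF (v / sk) j.
Proof.
move=> j0; apply: a2_eF => //; first by rewrite -sk2; field.
by rewrite mulrC divfK.
Qed.

Lemma a2_eFN_eigen (i j : 'I_n) : j != 0 ->
  a2 i *m eF (- (v / sk)) j = (- sk * w ^- (i * j)) *: eF (- (v / sk)) j.
Proof.
move=> j0; apply: a2_eF => //; first by rewrite -sk2; field.
by rewrite mulrNN mulrC divfK.
Qed.

Lemma a3_eF_eigen (j : 'I_n) : j != 0 ->
  (X - S) *m eF (v / sk) j = 0 *: eF (v / sk) j.
Proof.
move=> j0; have Xe : X *m eF (v / sk) j = 0 *: eF (v / sk) j.
  by rewrite X_eF // scale0r.
rewrite (a3_eigen Xe (fun i => a2_eF_eigen i j0)) -mulr_sumr sum_omegaV //.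
by rewrite mulr0 subr0.
Qed.

Lemma a3_eFN_eigen (j : 'I_n) : j != 0 ->
  (X - S) *m eF (- (v / sk)) j = 0 *: eF (- (v / sk)) j.
Proof.
move=> j0; have Xe : X *m eF (- (v / sk)) j = 0 *: eF (- (v / sk)) j.
  by rewrite X_eF // scale0r.
rewrite (a3_eigen Xe (fun i => a2_eFN_eigen i j0)) -mulr_sumr sum_omegaV //.
by rewrite mulr0 subr0.
Qed.

Section Strict.
Variables sv svk rho : C.
Hypothesis sv0 : sv != 0.
Hypothesis sv2 : sv * sv = v - 1.
Hypothesis svk0 : svk != 0.
Hypothesis svk2 : svk * svk = v - k.
Hypothesis rhoE : rho = sk * svk / sv.
Local Notation r := (sv / (svk * sk)).

Let rho_r : rho * r = 1.
Proof. by rewrite rhoE; field; rewrite sv0 svk0 sk0. Qed.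

Let r_kl : r * (k - l) = rho.
Proof.
(* The parameter identity rearranged; it makes [k - l] the square of [rho]. *)
have kl : (k - l) * (v - 1) = k * (v - k).
  rewrite mulrBr (mulrBr k) kk; ring.
have -> : r * (k - l) = ((k - l) * (sv * sv)) / (sv * svk * sk).
  by field; rewrite sv0 svk0 sk0.
rewrite sv2 kl -svk2 -sk2 rhoE.
by field; rewrite sv0 svk0 sk0.
Qed.

Lemma a2_eD_eigen i : a2 i *m eD r = rho *: eD r.
Proof. exact: a2_eD. Qed.

Lemma a2_eDN_eigen i : a2 i *m eD (- r) = - rho *: eD (- r).
Proof. by apply: a2_eD; rewrite ?mulrNN // mulNr r_kl. Qed.

Lemma a3_eD_eigen : (X - S) *m eD r = (- nC * rho) *: eD r.
Proof.
have Xe : X *m eD r = 0 *: eD r by rewrite X_eD scale0r.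
by rewrite (a3_eigen Xe a2_eD_eigen) sumC sub0r mulNr.
Qed.

Lemma a3_eDN_eigen : (X - S) *m eD (- r) = (nC * rho) *: eD (- r).
Proof.
have Xe : X *m eD (- r) = 0 *: eD (- r) by rewrite X_eD scale0r.
by rewrite (a3_eigen Xe a2_eDN_eigen) sumC sub0r mulrN opprK.
Qed.

End Strict.
End Roots.

Lemma a0_eD0_eigen i : a0 i *m (2 *: eD 0) = 1 *: (2 *: eD 0).
Proof. by rewrite -scalemxAr a0_eD scale1r. Qed.

Lemma a1_eD0_eigen : (D - T) *m (2 *: eD 0) = - nC *: (2 *: eD 0).
Proof. by rewrite -scalemxAr a1_eD_eigen !scalerA [2 * - nC]mulrC. Qed.

Lemma a2_eD0_eigen i : v *: S = k *: X -> a2 i *m (2 *: eD 0) = 0 *: (2 *: eD 0).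
Proof. by move=> SX; rewrite -scalemxAr a2_eD0 // scaler0 scale0r. Qed.

End Spectrum.

(** * Sums over labels *)

Section Labels.
Variables (m : nat) (V : nmodType).

Lemma rel_lt_decK : cancel (@rel_lt_dec m) (@rel_lt_enc m).
Proof. by case=> [[]|[]]. Qed.

Lemma rel_eq_decK : cancel (@rel_eq_dec m) (@rel_eq_enc m).
Proof. by case=> [[]|[]]. Qed.

Lemma idm_lt_decK : cancel (@idm_lt_dec m) (@idm_lt_enc m).
Proof. by case=> [[]|[[] []]]. Qed.

Lemma idm_eq_decK : cancel (@idm_eq_dec m) (@idm_eq_enc m).
Proof. by case=> [[]|[[]|]]. Qed.

Lemma sum_rel_lt (f : rel_lt m -> V) :
  \sum_l f l = \sum_i f (LA0 i) + \sum_i f (LA2 i) + f LA1 + f LA3.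
Proof.
rewrite (reindex (@rel_lt_dec m)) /=; last first.
  exact/onW_bij/(Bijective rel_lt_decK (@rel_lt_encK m)).
by rewrite !big_sumType /= big_bool /= !addrA.
Qed.

Lemma sum_rel_eq (f : rel_eq m -> V) :
  \sum_l f l = \sum_i f (MA0 i) + \sum_i f (MA2 i) + f MA1.
Proof.
rewrite (reindex (@rel_eq_dec m)) /=; last first.
  exact/onW_bij/(Bijective rel_eq_decK (@rel_eq_encK m)).
by rewrite !big_sumType /= (big_pred1 tt) // => -[].
Qed.

Lemma sum_idm_lt (f : idm_lt m -> V) :
  \sum_e f e = \sum_j f (LE3 j) + \sum_j f (LE4 j) +
               (f LE0 + f LE1 + (f LE21 + f LE22)).
Proof.
rewrite (reindex (@idm_lt_dec m)) /=; last first.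
  exact/onW_bij/(Bijective idm_lt_decK (@idm_lt_encK m)).
rewrite !big_sumType /=; congr (_ + _).
transitivity (\sum_(p : bool * bool) f (idm_lt_dec (inr (p.1, p.2)))).
  by apply: eq_bigr => -[].
rewrite -(pair_bigA _ (fun a b => f (idm_lt_dec (inr (a, b))))) /=.
by rewrite !big_bool.
Qed.

Lemma sum_idm_eq (f : idm_eq m -> V) :
  \sum_e f e = \sum_j f (ME3 j) + \sum_j f (ME4 j) + (f ME0 + f ME1 + f ME2).
Proof.
rewrite (reindex (@idm_eq_dec m)) /=; last first.
  exact/onW_bij/(Bijective idm_eq_decK (@idm_eq_encK m)).
rewrite !big_sumType /=; congr (_ + _).
rewrite (bigD1 (Some true)) //= (bigD1 (Some false)) //= (bigD1 None) //=.
by rewrite big_pred0 ?addr0 ?addrA // => -[[]|].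
Qed.

Lemma card_nonzero_idx : #|{: nonzero_idx m}| = m.
Proof. by rewrite card_sig (cardC1 (0 : 'I_m.+1)) card_ord. Qed.

(** Both sides are [2 n + 2]; in the case [k = v] below, both are [2 n + 1]. *)
Lemma card_labels_lt : #|{: idm_lt m}| = #|{: rel_lt m}|.
Proof.
rewrite (bij_eq_card (Bijective (@idm_lt_encK m) idm_lt_decK)).
rewrite (bij_eq_card (Bijective (@rel_lt_encK m) rel_lt_decK)).
rewrite !card_sum card_prod !card_bool card_nonzero_idx card_ord.
by rewrite !addSn !addnS.
Qed.

Lemma card_labels_eq : #|{: idm_eq m}| = #|{: rel_eq m}|.
Proof.
rewrite (bij_eq_card (Bijective (@idm_eq_encK m) idm_eq_decK)).
rewrite (bij_eq_card (Bijective (@rel_eq_encK m) rel_eq_decK)).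
rewrite !card_sum card_option card_bool card_unit card_nonzero_idx card_ord.
by rewrite !addSn !addnS.
Qed.

End Labels.

(** * The scheme of a balanced generalized weighing matrix *)

Section SquareRoots.
Variable R : realType.

Lemma sqCM (x y : R) : 0 <= x -> sqC (x * y) = sqC x * sqC y.
Proof. by move=> x0; rewrite /sqC sqrtrM // rmorphM. Qed.

Lemma sqCV (x : R) : 0 <= x -> sqC x^-1 = (sqC x)^-1.
Proof. by move=> x0; rewrite /sqC sqrtrV // fmorphV. Qed.

Lemma sqC_neq0 (x : R) : 0 < x -> sqC x != 0.
Proof. by move=> x0; rewrite /sqC fmorph_eq0 sqrtr_eq0 -ltNge. Qed.

Lemma sqC_sqr (x : R) : 0 <= x -> sqC x * sqC x = real_complex R x.
Proof. by move=> x0; rewrite /sqC -rmorphM -expr2 sqr_sqrtr. Qed.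

End SquareRoots.

Section Scheme.
Variables (R : realType) (m v k lam : nat) (W : 'M[option 'I_m.+1]_v).
Hypothesis hW : is_BGW k lam W.
Hypothesis hv : (1 < v)%N.
Hypothesis hk : (0 < k)%N.
Hypothesis hkv : (k <= v)%N.
Hypothesis hnd : m.+1 = 1%N -> (k < v)%N -> (lam < k)%N.
Variable opp : bool.

Local Notation n := (m.+1).
Local Notation C := R[i].
Local Notation w := (omega R m).
Local Notation vR := (v%:R : R).
Local Notation kR := (k%:R : R).
Local Notation vC := (v%:R : C).
Local Notation kC := (k%:R : C).
Local Notation nC := (n%:R : C).
Local Notation lC := (lam%:R : C).
Local Notation N := (n * v + n * v)%N.
Local Notation c0 := ((2 * n * v)%:R^-1 : C).
Local Notation a0 := (@A0 R m v).
Local Notation a2 := (A2_ R W opp).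
Local Notation D := (Dmx R m v).
Local Notation X := (Xmx R m v).
Local Notation T := (\sum_i a0 i).
Local Notation S := (\sum_i a2 i).
Local Notation sv := (sqC (vR - 1)).
Local Notation svk := (sqC (vR - kR)).
Local Notation sk := (sqC kR).
Local Notation r := (sv / (svk * sk)).

Lemma A2_E i : a2 i = A2n R W (if opp then i else - i).
Proof. by rewrite /A2_ /A2n; case: opp; rewrite ?opprK. Qed.

(** Reversing the orientation only permutes the summands. Hence [A3 = X - S] holds for both
    orientations, and so do the expansions that define [P] and [Q]. *)
Lemma sum_A2_ : S = \sum_i A2n R W i.
Proof.
rewrite (eq_bigr _ (fun i _ => A2_E i)); case: opp; first by [].
by rewrite [RHS](reindex_inj oppr_inj).
Qed.

Lemma A1_T : A1 R m v = D - T.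
Proof. exact: A1E. Qed.

Lemma A3_A2_ : A3 R W = X - S.
Proof. by rewrite sum_A2_ A3E. Qed.

Let n0 : nC != 0. Proof. by rewrite pnatr_eq0. Qed.
Let v0 : vC != 0. Proof. by rewrite pnatr_eq0 -lt0n ltnW. Qed.
Let c0E : c0 = (2 * nC * vC)^-1. Proof. by rewrite !natrM. Qed.

Let N_c0 : (N%:R : C)^-1 = c0.
Proof. by rewrite addnn -mul2n mulnA. Qed.

Lemma order_gt0 : (0 < N)%N.
Proof. by rewrite addn_gt0 muln_gt0 /= ltnW. Qed.

Let sk0 : sk != 0. Proof. by rewrite sqC_neq0 // ltr0n. Qed.

Let sk2 : sk * sk = kC.
Proof. by rewrite sqC_sqr ?ler0n // rmorph_nat. Qed.

Let v1R : 0 < vR - 1. Proof. by rewrite subr_gt0 ltr1n. Qed.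
Let sv0 : sv != 0. Proof. by rewrite sqC_neq0. Qed.
Let sv2 : sv * sv = vC - 1.
Proof. by rewrite sqC_sqr ?ltW // rmorphB rmorph1 rmorph_nat. Qed.

Section Strict.
Hypothesis ltkv : (k < v)%N.

Let vkR : 0 < vR - kR. Proof. by rewrite subr_gt0 ltr_nat. Qed.
Let svk0 : svk != 0. Proof. by rewrite sqC_neq0. Qed.
Let svk2 : svk * svk = vC - kC.
Proof. by rewrite sqC_sqr ?ltW // rmorphB !rmorph_nat. Qed.

Let k_ge0 : 0 <= kR. Proof. exact: ler0n. Qed.

Lemma sqC_rho : sqC (kR * (vR - kR) / (vR - 1)) = sk * svk / sv.
Proof.
have h1 := ltW v1R; have h2 := ltW vkR.
by rewrite !sqCM ?sqCV ?mulr_ge0.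
Qed.

Lemma sqC_A2 : sqC ((vR - 1) * (vR - kR) / kR) = sv * svk / sk.
Proof.
have h1 := ltW v1R; have h2 := ltW vkR.
by rewrite !sqCM ?sqCV ?mulr_ge0.
Qed.

Lemma sqC_A3 : sqC ((vR - 1) * kR / (vR - kR)) = sv * sk / svk.
Proof.
have h1 := ltW v1R; have h2 := ltW vkR.
by rewrite !sqCM ?sqCV ?mulr_ge0.
Qed.

Lemma E21_eD : E21 R k W opp = eD a0 a2 D X c0 vC kC r.
Proof.
have e2 : sqC ((vR - 1) * (vR - kR)) / sk = sv * svk / sk by rewrite sqCM ?ltW.
have e3 : sqC ((vR - 1) * kR) / svk = sv * sk / svk by rewrite sqCM ?ltW.
symmetry; exact: (eD_E _ A1_T A3_A2_ sk0 sk2 svk0 svk2 e2 e3).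
Qed.

Lemma E22_eD : E22 R k W opp = eD a0 a2 D X c0 vC kC (- r).
Proof.
have e2 : sqC ((vR - 1) * (vR - kR)) / sk = sv * svk / sk by rewrite sqCM ?ltW.
have e3 : sqC ((vR - 1) * kR) / svk = sv * sk / svk by rewrite sqCM ?ltW.
symmetry; exact: (eDN_E _ A1_T A3_A2_ sk0 sk2 svk0 svk2 e2 e3).
Qed.

End Strict.

Lemma E0_eJ : E0 R W opp = eJ D X c0 1.
Proof. by rewrite (eJ1E _ A1_T A3_A2_). Qed.

Lemma E1_eJ : E1 R W opp = eJ D X c0 (-1).
Proof. by rewrite (eJN1E _ A1_T A3_A2_). Qed.

Lemma E3_eF j : E3 R k W opp j = eF a0 a2 c0 vC (vC / sk) j.
Proof. by rewrite eF_sumE. Qed.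

Lemma E4_eF j : E4 R k W opp j = eF a0 a2 c0 vC (- (vC / sk)) j.
Proof. by rewrite eF_sumBE. Qed.

Lemma E2_eD : k = v -> E21 R k W opp + E22 R k W opp = 2 *: eD a0 a2 D X c0 vC kC 0.
Proof. by move=> kv; exact: (eD0_E _ _ _ _ _ A1_T (A3_eq0 R hW kv)). Qed.

Definition spec_lt (e : idm_lt m) : 'M[C]_N :=
  match e with
  | LE0 => eJ D X c0 1
  | LE1 => eJ D X c0 (-1)
  | LE21 => eD a0 a2 D X c0 vC kC r
  | LE22 => eD a0 a2 D X c0 vC kC (- r)
  | LE3 j => eF a0 a2 c0 vC (vC / sk) (val j)
  | LE4 j => eF a0 a2 c0 vC (- (vC / sk)) (val j)
  end.

Definition spec_eq (e : idm_eq m) : 'M[C]_N :=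
  match e with
  | ME0 => eJ D X c0 1
  | ME1 => eJ D X c0 (-1)
  | ME2 => 2 *: eD a0 a2 D X c0 vC kC 0
  | ME3 j => eF a0 a2 c0 vC (vC / sk) (val j)
  | ME4 j => eF a0 a2 c0 vC (- (vC / sk)) (val j)
  end.

Lemma idem_ltE : (k < v)%N -> forall e, idem_lt R k W opp e = spec_lt e.
Proof.
move=> ltkv [||||j|j]; [exact: E0_eJ | exact: E1_eJ | exact: E21_eD |
  exact: E22_eD | exact: E3_eF | exact: E4_eF].
Qed.

Lemma idem_eqE : k = v -> forall e, idem_eq R k W opp e = spec_eq e.
Proof.
move=> kv [|||j|j]; [exact: E0_eJ | exact: E1_eJ | exact: E2_eD |
  exact: E3_eF | exact: E4_eF].
Qed.

Lemma first_eigenmatrix_lt : (k < v)%N ->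
  first_eigenmatrix (adj_lt R W opp) (idem_lt R k W opp) (P_lt R v k).
Proof.
move=> ltkv l; have svk0 : svk != 0 by rewrite sqC_neq0 // subr_gt0 ltr_nat.
have A1T := A1_T; have A3S := A3_A2_; have rhoE := sqC_rho ltkv.
rewrite (eq_bigr _ (fun e _ => congr1 ( *:%R _) (idem_ltE ltkv e))) sum_idm_lt.
symmetry; case: l => [i||i|].
- exact: a0_expansion_lt.
- exact: a1_expansion_lt.
- exact: a2_expansion_lt.
- exact: a3_expansion_lt.
Qed.

Lemma first_eigenmatrix_eq : k = v ->
  first_eigenmatrix (adj_eq R W opp) (idem_eq R k W opp) (P_eq R v k).
Proof.
move=> kv l; have A1T := A1_T; have A3S := A3_A2_.
have A30 := A3_eq0 R hW kv; have kvC : kC = vC by rewrite kv.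
rewrite (eq_bigr _ (fun e _ => congr1 ( *:%R _) (idem_eqE kv e))) sum_idm_eq.
symmetry; case: l => [i||i].
- exact: a0_expansion_eq.
- exact: a1_expansion_eq.
- exact: (a2_expansion_eq _ _ A3S n0 v0 c0E sk0 A30 kvC).
Qed.

Lemma second_eigenmatrix_lt : (k < v)%N ->
  second_eigenmatrix (adj_lt R W opp) (idem_lt R k W opp) (Q_lt R v k).
Proof.
move=> ltkv e; have svk0 : svk != 0 by rewrite sqC_neq0 // subr_gt0 ltr_nat.
have svk2 : svk * svk = vC - kC.
  by rewrite sqC_sqr ?subr_ge0 ?ler_nat // rmorphB !rmorph_nat.
have A1T := A1_T; have A3S := A3_A2_.
have s2E := sqC_A2 ltkv; have s3E := sqC_A3 ltkv.
rewrite idem_ltE // N_c0 sum_rel_lt; case: e => [||||j|j].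
- exact: eJ_expand.
- exact: eJ_expand.
- exact: eD_expand.
- exact: eDN_expand.
- by rewrite /= !scale0r !addr0 eF_expand.
- by rewrite /= !scale0r !addr0 eF_expand.
Qed.

Lemma second_eigenmatrix_eq : k = v ->
  second_eigenmatrix (adj_eq R W opp) (idem_eq R k W opp) (Q_eq R v k).
Proof.
move=> kv e; have A1T := A1_T; have A3S := A3_A2_; have A30 := A3_eq0 R hW kv.
rewrite idem_eqE // N_c0 sum_rel_eq; case: e => [|||j|j].
- exact: (eJ_expand_eq _ A1T A3S A30).
- exact: (eJ_expand_eq _ A1T A3S A30).
- exact: eD0_expand.
- by rewrite /= !scale0r !addr0 eF_expand.
- by rewrite /= !scale0r !addr0 eF_expand.
Qed.

Lemma adj_lt_neq0 : (k < v)%N -> forall l, adj_lt R W opp l != 0.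
Proof.
move=> ltkv [i||i|] /=; first exact: A0_neq0.
- exact: A1_neq0.
- rewrite A2_E; exact: (A2n_neq0 R hW hv hk hkv hnd).
- exact: (A3_neq0 R hW hv hk hkv hnd).
Qed.

Lemma adj_eq_neq0 l : adj_eq R W opp l != 0.
Proof.
case: l => [i||i] /=; first exact: A0_neq0.
- exact: A1_neq0.
- rewrite A2_E; exact: (A2n_neq0 R hW hv hk hkv hnd).
Qed.

Lemma adj_lt_01 l x y : adj_lt R W opp l x y = 0 \/ adj_lt R W opp l x y = 1.
Proof.
case: l => [i||i|] /=; [exact: A0_01 | exact: A1_01 | | exact: A3_01].
rewrite A2_E; exact: A2n_01.
Qed.

Lemma adj_eq_01 l x y : adj_eq R W opp l x y = 0 \/ adj_eq R W opp l x y = 1.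
Proof.
case: l => [i||i] /=; [exact: A0_01 | exact: A1_01 | ].
rewrite A2_E; exact: A2n_01.
Qed.

Let TSDX : T + S + (D - T) + (X - S) = const_mx 1.
Proof.
rewrite -DX_const; move: T S => p q.
by rewrite -addrA addrACA [p + _]addrC subrK [q + _]addrC subrK.
Qed.

Lemma adj_lt_sum : \sum_l adj_lt R W opp l = const_mx 1.
Proof. by rewrite sum_rel_lt /= A1_T A3_A2_ TSDX. Qed.

Lemma adj_eq_sum : k = v -> \sum_l adj_eq R W opp l = const_mx 1.
Proof.
by move=> kv; rewrite sum_rel_eq /= A1_T -TSDX -A3_A2_ (A3_eq0 R hW kv) addr0.
Qed.

Lemma E0_const : E0 R W opp = N%:R^-1 *: const_mx 1.
Proof. by rewrite E0_eJ N_c0 -DX_const /eJ scale1r. Qed.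

Section Oriented.
Hypothesis ho : forall i, a2 i = A2n R W i.

(** Orientation matters here: [rel_a0a2] requires [A0 i] to shift the index of the second family by
    [+ i], as it does for [A2n]. *)
Lemma bgw_relations : bm_relations a0 a2 D X vC kC lC.
Proof.
split=> *; rewrite ?ho.
- exact: A0_mul_A0.
- exact: A0_mul_A2n.
- exact: A2n_mul_A0.
- rewrite (A2n_mul_A2n R hW hv hk hkv hnd) A1_T; reflexivity.
- exact: A0_mul_D.
- exact: A0_mul_X.
- exact: (A2n_mul_D R hW hv hk hkv hnd).
- exact: (A2n_mul_X R hW hv hk hkv hnd).
- exact: D_mul_A0.
- exact: X_mul_A0.
- exact: (D_mul_A2n R hW hv hk hkv hnd).
- exact: (X_mul_A2n R hW hv hk hkv hnd).
- exact: D_mul_D.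
- exact: D_mul_X.
- exact: X_mul_D.
- exact: X_mul_X.
- exact: (param_eq R hW hv hk hkv hnd).
Qed.

Lemma eigen_lt : (k < v)%N -> forall l e,
  adj_lt R W opp l *m idem_lt R k W opp e = P_lt R v k e l *: idem_lt R k W opp e.
Proof.
move=> ltkv l e; rewrite idem_ltE //; have rels := bgw_relations.
have svk0 : svk != 0 by rewrite sqC_neq0 // subr_gt0 ltr_nat.
have svk2 : svk * svk = vC - kC.
  by rewrite sqC_sqr ?subr_ge0 ?ler_nat // rmorphB !rmorph_nat.
have rhoE := sqC_rho ltkv.
case: l => [i||i|]; rewrite [adj_lt _ _ _ _]/= ?A1_T ?A3_A2_.
- case: e => [||||j|j]; [exact: (a0_eJ_eigen _ rels) | exact: (a0_eJ_eigen _ rels) |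
    exact: (a0_eD_eigen _ rels) | exact: (a0_eD_eigen _ rels) |
    exact: (a0_eF _ rels) | exact: (a0_eF _ rels)].
- case: e => [||||j|j]; [exact: (a1_eJ_eigen _ rels) | exact: (a1_eJ_eigen _ rels) |
    exact: (a1_eD_eigen _ rels) | exact: (a1_eD_eigen _ rels) |
    exact: (a1_eF_eigen _ rels _ (valP j)) | exact: (a1_eF_eigen _ rels _ (valP j))].
- case: e => [||||j|j]; [exact: (a2_eJ1_eigen _ rels) | exact: (a2_eJN1_eigen _ rels) |
    exact: (a2_eD_eigen _ rels) | exact: (a2_eDN_eigen _ rels) |
    exact: (a2_eF_eigen _ rels sk0 sk2 _ (valP j)) |
    exact: (a2_eFN_eigen _ rels sk0 sk2 _ (valP j))].
- case: e => [||||j|j]; [exact: (a3_eJ1_eigen _ rels) | exact: (a3_eJN1_eigen _ rels) |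
    exact: (a3_eD_eigen _ rels) | exact: (a3_eDN_eigen _ rels) |
    exact: (a3_eF_eigen _ rels sk0 sk2 (valP j)) |
    exact: (a3_eFN_eigen _ rels sk0 sk2 (valP j))].
Qed.

Lemma eigen_eq : k = v -> forall l e,
  adj_eq R W opp l *m idem_eq R k W opp e = P_eq R v k e l *: idem_eq R k W opp e.
Proof.
move=> kv l e; rewrite idem_eqE //; have rels := bgw_relations.
have SX : vC *: S = kC *: X.
  rewrite kv; congr (_ *: _); apply/esym/eqP.
  by rewrite -subr_eq0 -A3_A2_ (A3_eq0 R hW kv).
case: l => [i||i]; rewrite [adj_eq _ _ _ _]/= ?A1_T.
- case: e => [|||j|j]; [exact: (a0_eJ_eigen _ rels) | exact: (a0_eJ_eigen _ rels) |
    exact: (a0_eD0_eigen _ rels) | exact: (a0_eF _ rels) | exact: (a0_eF _ rels)].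
- case: e => [|||j|j]; [exact: (a1_eJ_eigen _ rels) | exact: (a1_eJ_eigen _ rels) |
    exact: (a1_eD0_eigen _ rels) |
    exact: (a1_eF_eigen _ rels _ (valP j)) | exact: (a1_eF_eigen _ rels _ (valP j))].
- case: e => [|||j|j]; [exact: (a2_eJ1_eigen _ rels) | exact: (a2_eJN1_eigen _ rels) |
    exact: (a2_eD0_eigen _ rels) |
    exact: (a2_eF_eigen _ rels sk0 sk2 _ (valP j)) |
    exact: (a2_eFN_eigen _ rels sk0 sk2 _ (valP j))].
Qed.

Lemma scheme_lt : (k < v)%N -> comm_assoc_scheme (LA0 0) (adj_lt R W opp).
Proof.
move=> ltkv; split; first exact: adj_lt_neq0.
split; first exact: adj_lt_01.
split; first exact: A0_0.
split; first exact: adj_lt_sum.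
split.
  move=> [i||i|] l0.
  - exists (LA0 (- i)); last exact: trA0.
    (* The index is extracted from the equality of labels by a projection, whose default value 0 is
       never reached. *)
    apply: contraNneq l0 => h; rewrite -(opprK i).
    by rewrite [- i](congr1 (fun l => if l is LA0 j then j else 0) h) oppr0.
  - by exists LA1 => //; exact: trA1.
  - by exists (LA2 (- i)) => //; rewrite /= !ho; exact: trA2n.
  - by exists LA3 => //; exact: trA3.
(* Closure under products and commutativity follow from the simultaneous diagonalization by the
   [E k]. *)
have AE := first_eigenmatrix_lt ltkv; have EA := second_eigenmatrix_lt ltkv.
split=> l l'; first exact: (relations_mul_closed AE EA (eigen_lt ltkv)).
exact: (relations_mulC AE (eigen_lt ltkv)).
Qed.

Lemma scheme_eq : k = v -> comm_assoc_scheme (MA0 0) (adj_eq R W opp).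
Proof.
move=> kv; split; first exact: adj_eq_neq0.
split; first exact: adj_eq_01.
split; first exact: A0_0.
split; first exact: adj_eq_sum.
split.
  move=> [i||i] l0.
  - exists (MA0 (- i)); last exact: trA0.
    apply: contraNneq l0 => h; rewrite -(opprK i).
    by rewrite [- i](congr1 (fun l => if l is MA0 j then j else 0) h) oppr0.
  - by exists MA1 => //; exact: trA1.
  - by exists (MA2 (- i)) => //; rewrite /= !ho; exact: trA2n.
have AE := first_eigenmatrix_eq kv; have EA := second_eigenmatrix_eq kv.
split=> l l'; first exact: (relations_mul_closed AE EA (eigen_eq kv)).
exact: (relations_mulC AE (eigen_eq kv)).
Qed.

Lemma primitive_lt : (k < v)%N ->
  primitive_idempotents LE0 (adj_lt R W opp) (idem_lt R k W opp).
Proof.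
move=> ltkv; apply: (eigenmatrices_primitive_idempotents (adj_lt_neq0 ltkv)
  adj_lt_01 adj_lt_sum order_gt0 (card_labels_lt m) (first_eigenmatrix_lt ltkv)
  (second_eigenmatrix_lt ltkv) (eigen_lt ltkv)).
exact: E0_const.
Qed.

Lemma primitive_eq : k = v ->
  primitive_idempotents ME0 (adj_eq R W opp) (idem_eq R k W opp).
Proof.
move=> kv; apply: (eigenmatrices_primitive_idempotents adj_eq_neq0
  adj_eq_01 (adj_eq_sum kv) order_gt0 (card_labels_eq m) (first_eigenmatrix_eq kv)
  (second_eigenmatrix_eq kv) (eigen_eq kv)).
exact: E0_const.
Qed.

End Oriented.
End Scheme.

(** * Passing between the two orientations of the [A2] family *)

Section Orientation.
Variables (R : realType) (m v k lam : nat) (W : 'M[option 'I_m.+1]_v).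
Hypothesis hW : is_BGW k lam W.
Hypothesis hv : (1 < v)%N.
Hypothesis hk : (0 < k)%N.
Hypothesis hkv : (k <= v)%N.
Hypothesis hnd : m.+1 = 1%N -> (k < v)%N -> (lam < k)%N.

(** In a cyclic group of order at most 2 the two orientations coincide, so the idempotents are
    primitive there for either value of [opp]. *)
Lemma oppr_ord_small (i : 'I_m.+1) : (m.+1 <= 2)%N -> - i = i.
Proof.
move: i; case: m => [|[|//]] i _; first by rewrite !ord1.
by apply: val_inj; case: i => [[|[|]]].
Qed.

Lemma A2_oriented opp i : opp || (m.+1 <= 2)%N -> A2_ R W opp i = A2n R W i.
Proof.
rewrite A2_E; case: opp => [_|]; first reflexivity.
by rewrite orFb => n2; rewrite (oppr_ord_small i n2).
Qed.

Lemma A2_opp opp i : A2_ R W opp i = A2_ R W true (if opp then i else - i).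
Proof. by rewrite !A2_E. Qed.

Lemma scheme_lt_any opp : (k < v)%N -> comm_assoc_scheme (LA0 0) (adj_lt R W opp).
Proof.
(* The scheme is established for [opp = true] and transported by [f], which is the identity for
   [opp = true] and negation otherwise. *)
move=> ltkv; pose f (i : 'I_m.+1) := if opp then i else - i.
have fK i : f (f i) = i by rewrite /f; case: (opp); rewrite ?opprK.
pose s (l : rel_lt m) := if l is LA2 i then LA2 (f i) else l.
have sK : involutive s.
  by case=> [i||i|]; [ | | exact: congr1 (fK i) | ].
have ho (i : 'I_m.+1) : A2_ R W true i = A2n R W i by apply: A2_oriented.
apply: (comm_assoc_scheme_reindex sK _ _ (scheme_lt hW hv hk hkv hnd ho ltkv)).
  reflexivity.
by case=> [i||i|]; [ | | exact: A2_opp | ].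
Qed.

Lemma scheme_eq_any opp : k = v -> comm_assoc_scheme (MA0 0) (adj_eq R W opp).
Proof.
move=> kv; pose f (i : 'I_m.+1) := if opp then i else - i.
have fK i : f (f i) = i by rewrite /f; case: (opp); rewrite ?opprK.
pose s (l : rel_eq m) := if l is MA2 i then MA2 (f i) else l.
have sK : involutive s.
  by case=> [i||i]; [ | | exact: congr1 (fK i)].
have ho (i : 'I_m.+1) : A2_ R W true i = A2n R W i by apply: A2_oriented.
apply: (comm_assoc_scheme_reindex sK _ _ (scheme_eq hW hv hk hkv hnd ho kv)).
  reflexivity.
by case=> [i||i]; [ | | exact: A2_opp].
Qed.

End Orientation.

Theorem theorem9 (R : realType) (m v k lam : nat)
    (W : 'M[option 'I_m.+1]_v)
    (hW : is_BGW k lam W)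
    (hv : (1 < v)%N) (hk : (0 < k)%N)
    (hnd : m.+1 = 1%N -> (k < v)%N -> (lam < k)%N)
    (opp : bool) :
  (k = v ->
     let A := @adj_eq R m v W opp in
     let E := @idem_eq R m v k W opp in
     [/\ comm_assoc_scheme (MA0 0%R) A,
         (opp || (m.+1 <= 2)%N -> primitive_idempotents ME0 A E),
         (forall P : idm_eq m -> rel_eq m -> R[i],
            first_eigenmatrix A E P <-> (forall e l, P e l = P_eq R v k e l)) &
         (forall Q : rel_eq m -> idm_eq m -> R[i],
            second_eigenmatrix A E Q <-> (forall l e, Q l e = Q_eq R v k l e))])
  /\
  ((k < v)%N ->
     let A := @adj_lt R m v W opp in
     let E := @idem_lt R m v k W opp in
     [/\ comm_assoc_scheme (LA0 0%R) A,
         (opp || (m.+1 <= 2)%N -> primitive_idempotents LE0 A E),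
         (forall P : idm_lt m -> rel_lt m -> R[i],
            first_eigenmatrix A E P <-> (forall e l, P e l = P_lt R v k e l)) &
         (forall Q : rel_lt m -> idm_lt m -> R[i],
            second_eigenmatrix A E Q <-> (forall l e, Q l e = Q_lt R v k l e))]).
Proof.
split=> hkv A E.
  have le_kv : (k <= v)%N by rewrite hkv.
  have AE := first_eigenmatrix_eq R hW hv hk opp hkv.
  have EA := second_eigenmatrix_eq R hW opp hkv.
  have A0 := adj_eq_neq0 R hW hv hk le_kv hnd opp.
  have A01 := adj_eq_01 R W opp.
  have AJ := adj_eq_sum R hW opp hkv.
  split; first exact: (scheme_eq_any R hW).
  (* Under [ho] the chosen family is [A2n], for which the eigenvector equations hold. The uniqueness
     claims below use only the expansions, so they cover both orientations. *)
  - move=> ho; apply: (primitive_eq hW hv hk le_kv hnd _ hkv) => i.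
    exact: A2_oriented.
  - exact: (first_eigenmatrix_unique A0 A01 AJ (order_gt0 m hv) (card_labels_eq m) AE EA).
  - exact: (second_eigenmatrix_unique A0 A01 AJ (order_gt0 m hv) EA).
have le_kv : (k <= v)%N by rewrite ltnW.
have AE := first_eigenmatrix_lt R W hv hk opp hkv.
have EA := second_eigenmatrix_lt R W hv hk le_kv opp hkv.
have A0 := adj_lt_neq0 R hW hv hk le_kv hnd opp hkv.
have A01 := adj_lt_01 R W opp.
have AJ := adj_lt_sum R W opp.
split; first exact: (scheme_lt_any R hW).
- move=> ho; apply: (primitive_lt hW hv hk le_kv hnd _ hkv) => i.
  exact: A2_oriented.
- exact: (first_eigenmatrix_unique A0 A01 AJ (order_gt0 m hv) (card_labels_lt m) AE EA).
- exact: (second_eigenmatrix_unique A0 A01 AJ (order_gt0 m hv) EA).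
Qed.
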